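(* Let $q>0$, $n\in\mathbb{N}$, $a>1$, $\lambda>0$, let $h_0(n),\dots,h_n(n)$ be real numbers with $|h_j(n)|\le1$, and let $Z_0(n,a),\dots,Z_n(n,a)\in\mathbb{C}$. Put $z_j=-ih_j(n)$ and assume that the Gram matrix $\big(E_q(z_k,z_j)\big)_{0\le k,j\le n}$ is strictly positive definite, where $E_q(z,w)=\sum_{m=0}^\infty\frac{(z\overline w)^m}{\Gamma(qm+1)}$. Let $$f_{n,q}(z)=\sum_{j=0}^nZ_j(n,a)E_q(z,z_j)$$ be the Mittag-Leffler superoscillation. For $w_0,\dots,w_n\in\mathbb{C}$ consider on the Mittag-Leffler Fock space $ML_q(\mathbb{C})$ the functional $$J(f)=\sum_{k=0}^n|w_k-f(z_k)|^2+\lambda\|f\|^2 .$$ Then $f_{n,q}$ is the minimizer of $J$ over $ML_q(\mathbb{C})$ if and only if $$w_k=\lambda Z_k(n,a)+\sum_{j=0}^nZ_j(n,a)\,E_q(-ih_k(n),-ih_j(n)),\qquad 0\le k\le n.$$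
   Context: The Mittag-Leffler Fock space $ML_q(\mathbb{C})$ is the Hilbert space of entire functions $f(z)=\sum_{m\ge0}a_mz^m$ with $$\|f\|^2=\frac1{q\pi}\int_{\mathbb{C}}|f(z)|^2|z|^{\frac2q-2}e^{-|z|^{2/q}}\,dA(z)<\infty,\qquad dA=dx\,dy.$$ Its reproducing kernel is $E_q(z,w)=\sum_{m=0}^\infty\frac{(z\overline w)^m}{\Gamma(qm+1)}$. *)

(* Defs.v *)
From HB Require Import structures.
From mathcomp Require Import all_boot all_order all_algebra.
From mathcomp Require Import complex.
From mathcomp Require Import all_classical all_reals all_analysis.
Set Implicit Arguments.
Unset Strict Implicit.
Unset Printing Implicit Defensive.
Import Order.TTheory GRing.Theory Num.Theory.
Import numFieldNormedType.Exports.
Import ComplexField.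
Local Open Scope classical_set_scope.
Local Open Scope ring_scope.
Local Open Scope complex_scope.
Local Open Scope sesquilinear_scope.

Definition Gamma (R : realType) (x : R) : R :=
  (\int[lebesgue_measure]_(t in `]0, +oo[) (t `^ (x - 1) * expR (- t)))%R.

(* Convergence in the complex plane is taken in [R[i]^o], i.e. for the topology
   of the complex modulus. *)
Definition mittag_leffler_kernel (R : realType) (q : R) (z w : R[i]) : R[i] :=
  limn (series (fun m => (z * w^* ) ^+ m / (Gamma (q * m%:R + 1))%:C)
        : nat -> R[i]^o).

(* Holomorphy on the whole plane, expressed as the existence of an everywhere
   convergent expansion f(z) = sum_m a_m z^m. *)
Definition entire (R : realType) (f : R[i] -> R[i]) : Prop :=
  exists a : nat -> R[i], forall z : R[i],
    (series (fun m => a m * z ^+ m) : nat -> R[i]^o) @ \oo --> (f z : R[i]^o).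

(* The squared norm, with value +oo when the integral diverges; dA is the
   product Lebesgue measure on R * R, with (x, y) standing for x + iy. *)
Definition ML_sqnorm (R : realType) (q : R) (f : R[i] -> R[i]) : \bar R :=
  (((q * pi)^-1)%:E *
   \int[lebesgue_measure \x lebesgue_measure]_(p in [set: R * R])
     let r := Normc.normc (p.1 +i* p.2) in
     (Normc.normc (f (p.1 +i* p.2)) ^+ 2 * r `^ (2 / q - 2) *
        expR (- (r `^ (2 / q))))%:E)%E.

Definition ML (R : realType) (q : R) : set (R[i] -> R[i]) :=
  [set f | entire f /\ (ML_sqnorm q f < +oo)%E].

Definition posdefmx (R : realType) (n : nat) (G : 'M[R[i]]_n) : Prop :=
  forall v : 'cV[R[i]]_n, v != 0 -> 0 < (v ^t* *m G *m v) 0 0.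

Definition gram_mx (R : realType) (q : R) (n : nat) (z : 'I_n -> R[i]) :
    'M[R[i]]_n :=
  \matrix_(k, j) mittag_leffler_kernel q (z k) (z j).

Definition superoscillation (R : realType) (q : R) (n : nat)
    (Z z : 'I_n -> R[i]) : R[i] -> R[i] :=
  fun x => \sum_(j < n) Z j * mittag_leffler_kernel q x (z j).

(* Finite on [ML q]; valued in [\bar R] because [ML_sqnorm] is. *)
Definition ridge_functional (R : realType) (q lambda : R) (n : nat)
    (z w : 'I_n -> R[i]) (f : R[i] -> R[i]) : \bar R :=
  ((\sum_(k < n) Normc.normc (w k - f (z k)) ^+ 2)%R%:E
   + lambda%:E * ML_sqnorm q f)%E.

Definition is_the_minimizer (R : realType) (T : Type) (J : T -> \bar R)
    (A : set T) (f : T) : Prop :=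
  [/\ A f, forall g, A g -> (J f <= J g)%E &
      forall g, A g -> (forall g', A g' -> (J g <= J g')%E) -> g = f].

(* Main.v *)
Require Import Defs.
From HB Require Import structures.
From mathcomp Require Import all_boot all_order all_algebra.
From mathcomp Require Import complex ring lra.
From mathcomp Require Import all_classical all_reals all_analysis.
From mathcomp Require Import measurable_realfun.
From mathcomp Require Import cyclic separable cyclotomic.
Set Implicit Arguments.
Unset Strict Implicit.
Unset Printing Implicit Defensive.
Import Order.TTheory GRing.Theory Num.Theory.
Import numFieldNormedType.Exports.
Local Open Scope classical_set_scope.
Local Open Scope ring_scope.
Import ComplexField.
Local Open Scope complex_scope.

(** The norm of the Mittag-Leffler Fock space is a weighted l2 norm of Taylor
coefficients: if f(z) = sum_m a_m z^m is entire, then in [0, +oo]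
  |f|^2 = sum_m |a_m|^2 Gamma(q m + 1)          [ML_sqnorm_parseval].
The kernel E_q(., w) has coefficients conj(w)^m / Gamma(q m + 1), so the
weights cancel in its pairing with a function g and what is left is the Taylor
series of g at w: the reproducing property is an identity between partial sums
[superosc_pairing].  In particular, with f the superoscillation and e = g - f,
  |g|^2 = |f|^2 + |e|^2 + 2 Re sum_k conj(Z_k) e(z_k)      [ML_sqnorm_shift].

Put c_k = w_k - lambda Z_k - f(z_k).  Expanding the squares then gives
  J(g) = J(f) + sum_k |e(z_k)|^2 + lambda |e|^2 - 2 Re sum_k conj(c_k) e(z_k)
[ridge_shift].  If c = 0, then f is a minimizer, and any other minimizer g has
|g - f| = 0, hence the same Taylor coefficients.  If c <> 0, the competitor
f + s K with K = sum_j c_j E_q(., z_j) and a small s > 0 does better, because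
the linear term is -2 s times the value at c of the Gram form, which is
positive.

The norm formula is obtained from rotations and radial integrals.  The measure
dA is invariant under rotations, which are products of shears, and
its image by |z|^2 is pi times Lebesgue measure on the half-line
[integral_radial], so that the squared norm of z^m is Gamma(q m + 1) by the
substitution s = u^q.  Averaging |f|^2 over the rotations by N-th roots of
unity leaves its integral over a disc unchanged [disc_average], and for a
polynomial of degree less than N the average is exactly sum_m |a_m|^2 |z|^(2m)
[roots_of_unity_parseval].  Letting N tend to infinity on a disc, where f is
bounded, and then the radius, gives the formula. *)

(** * Affine substitutions on the line *)

Section affine.
Variable R : realType.
Local Notation mu := (@lebesgue_measure R).
Local Open Scope ereal_scope.

Lemma measurable_affine (c d : R) :
  measurable_fun setT (fun x : measurableTypeR R => (c * x + d)%R : measurableTypeR R).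
Proof. by apply: measurable_funD => //; exact: measurable_funM. Qed.

(** Both sides are measures in A that agree on the intervals ]a, b]. *)
Lemma lebesgue_measure_affine (c d : R) (c0 : (0 < c)%R) (A : set R) :
  measurable A ->
  mu A = c%:E * mu ((fun x => c * x + d)%R @^-1` A).
Proof.
move=> mA.
pose phi (x : measurableTypeR R) : measurableTypeR R := (c * x + d)%R.
have mphi : measurable_fun setT phi := measurable_affine c d.
pose nu := mscale (NngNum (ltW c0)) 
  (measure_function_pushforward__canonical__measure_function_Measure mu mphi).
rewrite (_ : _ * _ = nu A)//.
apply: lebesgue_measure_unique => // X [[a b] _ /= <-].
rewrite /nu /mscale /= /pushforward.
rewrite (_ : phi @^-1` _ = `](a - d) / c, (b - d) / c]%classic)%R; last first.
  apply/seteqP; split => x /=; rewrite /phi !in_itv /= ltr_pdivrMr// ler_pdivlMr//;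
  by rewrite ltrBlDr lerBrDr mulrC.
rewrite !lebesgue_measure_itv /= !lte_fin ltr_pM2r ?invr_gt0// ltrD2r.
case: ifPn => ab; last by rewrite mule0.
rewrite -!EFinD -EFinM -mulrBl mulrCA mulfV ?gt_eqF// mulr1; congr EFin; ring.
Qed.

Lemma integral_affine (c d : R) (f : R -> \bar R) : (0 < c)%R ->
  measurable_fun setT f -> (forall x, 0 <= f x) ->
  \int[mu]_x f x = c%:E * \int[mu]_x f (c * x + d)%R.
Proof.
move=> c0 mf f0.
pose phi (x : measurableTypeR R) : measurableTypeR R := (c * x + d)%R.
have mphi : measurable_fun setT phi := measurable_affine c d.
pose nu := mscale (NngNum (ltW c0)) 
  (measure_function_pushforward__canonical__measure_function_Measure mu mphi).
transitivity (\int[nu]_x f x).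
  by apply: eq_measure_integral => A mA _; exact: lebesgue_measure_affine.
rewrite ge0_integral_mscale//=.
by rewrite ge0_integral_pushforward.
Qed.
End affine.

(** * Lebesgue measure on the plane *)

Section plane.
Variable R : realType.
Local Notation mu := (@lebesgue_measure R).
Local Notation mu2 := (mu \x mu)%E.
Local Notation R2 := (measurableTypeR R * measurableTypeR R)%type.
Local Open Scope ereal_scope.
Implicit Types F : R2 -> \bar R.

Lemma measurable_planar_map (a b c d : R) :
  measurable_fun setT (fun p : R2 =>
    (a * p.1 + b * p.2, c * p.1 + d * p.2)%R : R2).
Proof.
by apply/measurable_fun_pairP; split => /=; apply: measurable_funD => //; exact: measurable_funM.
Qed.

(** By Tonelli a shear acts on each horizontal line as a translation. *)
Lemma integral_shear1 (t : R) F : measurable_fun setT F -> (forall p, 0 <= F p) ->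
  \int[mu2]_p F p = \int[mu2]_p F (p.1 + t * p.2, p.2)%R.
Proof.
move=> mF F0.
rewrite (fubini_tonelli2 F)// (fubini_tonelli2 (fun p : R2 => F (p.1 + t * p.2, p.2)%R))//;
    last first.
  have := measurableT_comp mF (measurable_planar_map 1 t 0 1).
  by apply: eq_measurable_fun => p _ /=; congr (F (_, _)); ring.
apply: eq_integral => y _; rewrite /fubini_G /=.
rewrite (integral_affine (t * y) (c := 1)) //; last first.
  exact: measurableT_comp.
by rewrite mul1e; apply: eq_integral => x _; rewrite mul1r.
Qed.

Lemma integral_shear2 (t : R) F : measurable_fun setT F -> (forall p, 0 <= F p) ->
  \int[mu2]_p F p = \int[mu2]_p F (p.1, p.2 + t * p.1)%R.
Proof.
move=> mF F0.
rewrite (fubini_tonelli1 F)// (fubini_tonelli1 (fun p : R2 => F (p.1, p.2 + t * p.1)%R))//;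
    last first.
  have := measurableT_comp mF (measurable_planar_map 1 0 t 1).
  by apply: eq_measurable_fun => p _ /=; congr (F (_, _)); ring.
apply: eq_integral => x _; rewrite /fubini_F /=.
rewrite (integral_affine (t * x) (c := 1)) //; last first.
  exact: measurableT_comp.
by rewrite mul1e; apply: eq_integral => y _; rewrite mul1r.
Qed.

(** A rotation by an angle other than pi is the product of a horizontal, a
vertical and again a horizontal shear, with slopes - s / (1 + c), s and
- s / (1 + c). *)
Lemma integral_rotation (c s : R) F : (c ^+ 2 + s ^+ 2 = 1)%R ->
  measurable_fun setT F -> (forall p, 0 <= F p) ->
  \int[mu2]_p F p = \int[mu2]_p F (c * p.1 - s * p.2, s * p.1 + c * p.2)%R.
Proof.
move=> cs mF F0.
(* The slope of the shears requires c != -1. *)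
wlog c1 : c s cs F mF F0 / (c != -1)%R.
  move=> H; have [c1|] := eqVneq c (-1)%R; last exact: H.
  have s0 : (s = 0)%R by apply/eqP; rewrite -sqrf_eq0; apply/eqP; move: cs; rewrite c1; lra.
  have h0 : (0 != -1 :> R)%R by rewrite eq_sym oppr_eq0 oner_eq0.
  (* The rotation by pi is the square of a quarter turn. *)
  rewrite (H 0%R 1%R _ F)//; last by ring.
  rewrite (H 0%R 1%R)//; last 2 first.
  - by ring.
  - have := measurableT_comp mF (measurable_planar_map 0 (-1) 1 0).
    by apply: eq_measurable_fun => p _ /=; congr (F (_, _)); ring.
  by apply: eq_integral => p _ /=; rewrite c1 s0; congr (F (_, _)); ring.
have c10 : (1 + c != 0)%R by rewrite addrC addr_eq0.
pose t := (- (s / (1 + c)))%R.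
rewrite (integral_shear1 t)// (integral_shear2 s) //; last first.
  have := measurableT_comp mF (measurable_planar_map 1 t 0 1).
  by apply: eq_measurable_fun => p _ /=; congr (F (_, _)); ring.
rewrite (integral_shear1 t)//; last first.
  have := measurableT_comp mF (measurable_planar_map (1 + t * s) t s 1).
  by apply: eq_measurable_fun => p _ /=; congr (F (_, _)); ring.
apply: eq_integral => p _ /=.
have ss : (s * s = (1 - c) * (1 + c))%R by lra.
have st : (s * t = c - 1)%R by rewrite /t mulrN mulrA ss mulfK// opprB.
have tt : (t + t * (1 + s * t) = - s)%R.
  by rewrite st /t; field.
congr (F (_, _)).
  transitivity ((1 + s * t) * p.1 + (t + t * (1 + s * t)) * p.2)%R; first by ring.
  by rewrite tt st; ring.
transitivity (s * p.1 + (1 + s * t) * p.2)%R; first by ring.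
by rewrite st; ring.
Qed.

Lemma integral_plane_scale (c : R) F : (0 < c)%R ->
  measurable_fun setT F -> (forall p, 0 <= F p) ->
  \int[mu2]_p F p = (c ^+ 2)%:E * \int[mu2]_p F (c * p.1, c * p.2)%R.
Proof.
move=> c0 mF F0.
have mF' : measurable_fun setT (fun p : R2 => F (p.1, c * p.2)%R).
  have := measurableT_comp mF (measurable_planar_map 1 0 0 c).
  by apply: eq_measurable_fun => p _ /=; congr (F (_, _)); ring.
have mF'' : measurable_fun setT (fun p : R2 => F (c * p.1, c * p.2)%R).
  have := measurableT_comp mF (measurable_planar_map c 0 0 c).
  by apply: eq_measurable_fun => p _ /=; congr (F (_, _)); ring.
transitivity (c%:E * \int[mu2]_p F (p.1, c * p.2)%R).
  rewrite (fubini_tonelli1 F)// (fubini_tonelli1 (fun p : R2 => F (p.1, c * p.2)%R))//.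
  rewrite -ge0_integralZl//; [|exact: measurable_fun_fubini_tonelli_F
    |by move=> *; exact: integral_ge0|exact: ltW].
  apply: eq_integral => x _; rewrite /fubini_F /= (integral_affine 0 c0) //; last first.
    exact: measurableT_comp.
  by congr *%E; apply: eq_integral => y _; rewrite addr0.
rewrite expr2 EFinM -muleA; congr *%E.
rewrite (fubini_tonelli2 (fun p : R2 => F (p.1, c * p.2)%R))// (fubini_tonelli2 (fun p : R2 =>
    F (c * p.1, c * p.2)%R))//.
rewrite -ge0_integralZl//; [|exact: measurable_fun_fubini_tonelli_G
    |by move=> *; exact: integral_ge0|exact: ltW].
apply: eq_integral => x _; rewrite /fubini_G /= (integral_affine 0 c0) //; last first.
  exact: measurableT_comp.
by congr *%E; apply: eq_integral => y _; rewrite addr0.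
Qed.

Lemma integral_plane_gauss :
  \int[mu2]_p (expR (- (p.1 ^+ 2 + p.2 ^+ 2)))%:E = (@pi R)%:E.
Proof.
rewrite (fubini_tonelli1 (fun p : R2 => (expR (- (p.1 ^+ 2 + p.2 ^+ 2)))%:E))//; last first.
  apply/measurable_EFinP; apply: measurableT_comp => //; apply: measurableT_comp => //.
  by apply: measurable_funD; apply: measurable_funX;
      [exact: measurable_fst|exact: measurable_snd].
rewrite /fubini_F /=.
under eq_integral => x _.
  under eq_integral => y _ do rewrite opprD expRD EFinM.
  rewrite ge0_integralZl//; last by apply/measurable_EFinP; exact: measurable_gauss_fun.
  rewrite integralT_gauss muleC; over.
rewrite ge0_integralZl//; last by apply/measurable_EFinP; exact: measurable_gauss_fun.
by rewrite integralT_gauss -EFinM -expr2 sqr_sqrtr// pi_ge0.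
Qed.
End plane.

(** * Integrals of radial functions *)

Section radial.
Variable R : realType.
Local Notation mu := (@lebesgue_measure R).
Local Notation mu2 := (mu \x mu)%E.
Local Notation R2 := (measurableTypeR R * measurableTypeR R)%type.
Local Open Scope ereal_scope.

Lemma integral_expRN (r : R) : (0 < r)%R ->
  \int[mu]_(x in `[0%R, +oo[) (expR (- (r * x)))%:E = (r^-1)%:E.
Proof.
move=> r0.
have mE : measurable_fun (T := measurableTypeR R) `[0%R, +oo[ (fun s : R =>
    (expR (- (r * s)))%:E).
  apply/measurable_EFinP; apply: measurableT_comp => //; apply: measurable_funTS.
  by apply: measurableT_comp => //; exact: measurable_funM.
have rI : r%:E * \int[mu]_(x in `[0%R, +oo[) (expR (- (r * x)))%:E = 1.
  rewrite -ge0_integralZl//=; last exact: ltW.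
  rewrite integral_mkcond -(integral_exponential_pdf r0); apply: eq_integral => x _.
  by rewrite /exponential_pdf !patchE; case: ifP => // _; rewrite EFinM mulNr.
by rewrite -[LHS]mul1e -(mulVf (lt0r_neq0 r0)) EFinM -muleA rI mule1.
Qed.

(** The squared modulus rather than the modulus, because its image measure has
a constant density. *)
Definition sqmod (p : R2) : measurableTypeR R := (p.1 ^+ 2 + p.2 ^+ 2)%R.

Lemma sqmod_ge0 p : (0 <= sqmod p)%R.
Proof. by rewrite addr_ge0// sqr_ge0. Qed.

Lemma measurable_sqmod : measurable_fun setT sqmod.
Proof.
by apply: measurable_funD; apply: measurable_funX; [exact: measurable_fst|exact: measurable_snd].
Qed.
Hint Resolve measurable_sqmod : core.

Lemma measurable_sqmod_preimage (A : set (measurableTypeR R)) : measurable A ->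
    measurable (sqmod @^-1` A).
Proof. by move=> mA; rewrite -[X in measurable X]setTI; exact: measurable_sqmod. Qed.

Local Notation disc b := (sqmod @^-1` `]-oo, b%R]).

Let mdisc b : measurable (disc b).
Proof. exact: measurable_sqmod_preimage. Qed.

(** The homothety of ratio sqrt b maps the unit disc onto this one. *)
Lemma disc_scale (b : R) : (0 < b)%R -> mu2 (disc b) = b%:E * mu2 (disc 1).
Proof.
move=> b0; rewrite -[disc b in LHS]setIT -[disc 1 in RHS]setIT -!integral_indic//.
rewrite (@integral_plane_scale _ (Num.sqrt b)); last 3 first.
- by rewrite sqrtr_gt0.
- by apply/measurable_EFinP; exact: measurable_indic.
- by move=> p; rewrite lee_fin.
rewrite sqr_sqrtr ?(ltW b0)//; congr *%E; apply: eq_integral => p _.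
have E : (sqmod (Num.sqrt b * p.1, Num.sqrt b * p.2) <= b)%R = (sqmod p <= 1)%R.
  by rewrite /sqmod/= !exprMn (sqr_sqrtr (ltW b0)) -mulrDr -[leRHS]mulr1 ler_pM2l.
congr EFin; rewrite !indicE; congr ((nat_of_bool _)%:R).
by apply/idP/idP; rewrite !inE /= !in_itv/= E.
Qed.

(** The disc lies between the squares [0, 1/2]^2 and [-1, 1]^2. *)
Lemma disc_unit_fin_gt0 : mu2 (disc 1) \is a fin_num /\ 0 < mu2 (disc 1).
Proof.
pose sq (a b : R) : set R2 := `[a, b]%classic `*` `[a, b]%classic.
have msq a b : measurable (sq a b) by exact: measurableX.
have sqE a b : (a < b)%R -> mu2 (sq a b) = ((b - a) * (b - a))%:E.
  by move=> ab; rewrite product_measure1E//= lebesgue_measure_itv /= lte_fin ab.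
split.
  rewrite ge0_fin_numE; last exact: measure_ge0.
  apply: (@le_lt_trans _ _ (mu2 (sq (-1) 1)%R)); last by rewrite sqE ?ltry//; lra.
  apply: le_measure; rewrite ?inE//.
  move=> [x y]; rewrite /sq /sqmod /= !in_itv/= => xy.
  split; apply/andP; split; nra.
apply: (@lt_le_trans _ _ (mu2 (sq 0 (1/2))%R)); first by rewrite sqE ?lte_fin//; lra.
apply: le_measure; rewrite ?inE//.
move=> [x y]; rewrite /sq /sqmod /= !in_itv/= => -[/andP[x0 x1] /andP[y0 y1]]; nra.
Qed.

(** The discs of squared radius b have measure proportional to b, hence as small
as desired. *)
Lemma disc_zero : mu2 (disc 0) = 0.
Proof.
have [kfin kpos] := disc_unit_fin_gt0.
apply/eqP; rewrite eq_le measure_ge0 andbT; apply/lee_addgt0Pr => e e0.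
rewrite add0e; pose b := (e / fine (mu2 (disc 1)))%R.
have fk : (0 < fine (mu2 (disc 1)))%R by rewrite -lte_fin fineK.
have b0 : (0 < b)%R by rewrite divr_gt0.
apply: (@le_trans _ _ (mu2 (disc b))).
  apply: le_measure; rewrite ?inE// => p /=; rewrite !in_itv/= => /le_trans; apply; exact: ltW.
by rewrite disc_scale// -[mu2 _]fineK// -EFinM divfK ?gt_eqF.
Qed.

Lemma disc_measure (b : R) : (0 <= b)%R -> mu2 (disc b) = b%:E * mu2 (disc 1).
Proof.
rewrite le_eqVlt => /predU1P[<-|]; first by rewrite mul0e disc_zero.
exact: disc_scale.
Qed.

Lemma disc_neg (b : R) : (b < 0)%R -> mu2 (disc b) = 0.
Proof.
move=> b0; rewrite (_ : disc b = set0) ?measure0//.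
by apply/seteqP; split => // p /=; rewrite in_itv/= => /le_lt_trans/(_ b0);
    rewrite ltNge sqmod_ge0.
Qed.

Let k := fine (mu2 (disc 1)).
Let k0 : (0 < k)%R. Proof. by have [kfin kpos] := disc_unit_fin_gt0; rewrite -lte_fin fineK. Qed.
Let kE : mu2 (disc 1) = k%:E. Proof. by have [kfin kpos] := disc_unit_fin_gt0; rewrite fineK. Qed.

(** Lebesgue measure on the negative half-line completes the image of the plane
measure to a measure on the whole line, which can be compared with a multiple
of Lebesgue measure on all intervals. *)
Let nu0 := measure_add
  (measure_function_pushforward__canonical__measure_function_Measure mu2 measurable_sqmod)
  (mscale (NngNum (ltW k0)) (mrestr mu (measurable_itv `]-oo, 0%R[))).

Lemma sqmod_pushforward (A : set R) : measurable A -> A `<=` `[0%R, +oo[ ->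
   pushforward mu2 sqmod A = k%:E * mu A.
Proof.
move=> mA A0.
have ki0 : (0 < k^-1)%R by rewrite invr_gt0.
pose nu := mscale (NngNum (ltW ki0)) nu0.
have nuE X : nu X = k^-1%:E * (mu2 (sqmod @^-1` X) + k%:E * mu (X `&` `]-oo, 0%R[)).
  by congr *%E; exact: measure_addE.
suff -> : mu A = k^-1%:E * (mu2 (sqmod @^-1` A) + k%:E * mu (A `&` `]-oo, 0%R[)).
  rewrite muleA -EFinM mulfV ?gt_eqF// mul1e.
  rewrite (_ : A `&` _ = set0) ?measure0 ?mule0 ?adde0//.
  apply/seteqP; split => // x /= [/A0/=]; rewrite !in_itv/= andbT => x0 /(le_lt_trans x0).
  by rewrite ltxx.
rewrite -nuE; apply: lebesgue_measure_unique => // X [[a b] _ /= <-].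
rewrite [RHS]nuE.
rewrite lebesgue_measure_itv/= lte_fin; case: ifPn => ab; last first.
  by rewrite set_itv_ge ?bnd_simp// set0I preimage_set0 !measure0 mule0 adde0 mule0.
have -> : mu2 (sqmod @^-1` `]a, b]) = mu2 (disc b) - mu2 (disc a).
  have sab : disc b `&` disc a = disc a.
    by apply: setIidr => p /=; rewrite !in_itv/= => /le_trans; apply; exact: ltW.
  have bfin : mu2 (disc b) < +oo.
    by have [/disc_neg ->//|b0] := ltP b 0%R; rewrite disc_measure// kE -EFinM ltry.
  have mD := @measureD _ _ _ mu2 _ _ (mdisc b) (mdisc a) bfin.
  rewrite sab in mD; rewrite -mD; congr (mu2 _); apply/seteqP; split => p /=; rewrite !in_itv/=.
    by move=> /andP[ap ->]; split => //; apply/negP; rewrite -ltNge.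
  by move=> [-> /negP]; rewrite -ltNge => ->.
have [a0|a0] := ltP a 0%R.
  rewrite (disc_neg a0) sube0.
  have [b0|b0] := ltP b 0%R.
    rewrite disc_neg// add0e setIidl; last first.
      by move=> x /=; rewrite !in_itv/= => /andP[_ /le_lt_trans]; exact.
    by rewrite lebesgue_measure_itv/= lte_fin ab -EFinB -!EFinM mulKf ?gt_eqF.
  rewrite disc_measure// kE (_ : _ `&` _ = `]a, 0%R[%classic); last first.
    apply/seteqP; split => x /=; rewrite !in_itv/=; first by move=> [/andP[-> _] ->].
    by move=> /andP[ax x0]; rewrite ax x0 (ltW (lt_le_trans x0 b0)).
  have -> : mu `]a, 0%R[%classic = (- a)%:E.
    by rewrite lebesgue_measure_itv/= lte_fin a0 -EFinB sub0r.
  rewrite -!EFinM -EFinD.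
  by congr EFin; field; rewrite gt_eqF.
rewrite (_ : _ `&` _ = set0); last first.
  apply/seteqP; split => x //=; rewrite !in_itv/= => -[/andP[ax _] x0].
  by move: (lt_trans ax x0); rewrite ltNge a0.
rewrite [X in k%:E * X]measure0 mule0 adde0 (disc_measure a0)
    (disc_measure (le_trans a0 (ltW ab))) kE.
by rewrite -!EFinM -EFinD; congr EFin; field; rewrite gt_eqF.
Qed.

(** Integrating exp (- |z|^2) over the plane gives the area of the unit disc by
the image measure, and pi as a product of two Gauss integrals. *)
Let kpi : k = pi.
Proof.
have mE : measurable_fun (T := measurableTypeR R) `[0%R, +oo[ (fun s : R => (expR (- s))%:E).
  by apply/measurable_EFinP; apply: measurableT_comp => //; apply: measurable_funTS.
have : \int[pushforward mu2 sqmod]_(s in `[0%R, +oo[) (expR (- s))%:E = pi%:E.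
  rewrite ge0_integral_pushforward//= -integral_plane_gauss.
  rewrite (_ : _ @^-1` _ = setT)//.
  by apply/seteqP; split => // p _ /=; rewrite in_itv/= sqmod_ge0.
rewrite (eq_measure_integral (mscale (NngNum (ltW k0)) mu)); last first.
  by move=> A mA A0; exact: sqmod_pushforward.
rewrite ge0_integral_mscale//= (_ : \int[mu]_(x in _) _ = 1).
  by rewrite mule1 => -[].
have := integral_expRN ltr01; rewrite invr1 => <-.
by apply: eq_integral => s _; rewrite mul1r.
Qed.

(** Integration in polar coordinates, with the squared radius as variable. *)
Lemma integral_radial (phi : R ->
    \bar R) : measurable_fun (T := measurableTypeR R) `[0%R, +oo[ phi -> (forall s, 0 <= phi s) ->
  \int[mu2]_p phi (p.1 ^+ 2 + p.2 ^+ 2)%R = pi%:E * \int[mu]_(s in `[0%R, +oo[) phi s.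
Proof.
move=> mphi phi0.
transitivity (\int[pushforward mu2 sqmod]_(s in `[0%R, +oo[) phi s).
  rewrite ge0_integral_pushforward//= (_ : _ @^-1` _ = setT)//.
  by apply/seteqP; split => // p _ /=; rewrite in_itv/= sqmod_ge0.
rewrite (eq_measure_integral (mscale (NngNum (ltW k0)) mu)); last first.
  by move=> A mA A0; exact: sqmod_pushforward.
by rewrite ge0_integral_mscale//= kpi.
Qed.

End radial.

(** * The Gamma function and the radial moments *)

Section gamma.
Variable R : realType.
Local Notation mu := (@lebesgue_measure R).
Local Open Scope ereal_scope.

(** This is u <= exp u at u = t / (2 a), raised to the power a. *)
Lemma powR_le_expR (a t : R) : (0 <= a)%R -> (0 <= t)%R ->
  (t `^ a <= (2 * a) `^ a * expR (t / 2))%R.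
Proof.
rewrite le_eqVlt => /predU1P[<- t0|a0 t0].
  by rewrite !powRr0 mul1r -expR0 ler_expR divr_ge0.
have a20 : (0 < 2 * a)%R by rewrite mulr_gt0.
have -> : (t `^ a = (2 * a) `^ a * (t / (2 * a)) `^ a)%R.
  by rewrite -powRM ?divr_ge0 ?(ltW a20)// mulrC divfK// lt0r_neq0.
rewrite ler_wpM2l ?powR_ge0//.
rewrite (_ : t / 2 = (t / (2 * a)) * a)%R; last by field; rewrite gt_eqF.
rewrite expRM; apply: ge0_ler_powR; rewrite ?nnegrE ?expR_ge0 ?(ltW a0) ?divr_ge0 ?(ltW a20)//.
by apply: le_trans (expR_ge1Dx _); rewrite lerDr.
Qed.

Lemma measurable_gamma_integrand (a : R) :
  measurable_fun setT (fun t : R => (t `^ a * expR (- t))%:E).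
Proof.
apply/measurable_EFinP; apply: measurable_funM; first exact: measurable_powR.
by apply: measurableT_comp => //; apply: measurableT_comp.
Qed.

(** Gamma is the finite part of an extended integral, 0 where that integral
diverges; here convergence comes from the domination by exp (- t / 2). *)
Lemma integral_Gamma (a : R) : (0 <= a)%R ->
  \int[mu]_(t in `]0%R, +oo[) (t `^ a * expR (- t))%:E = (Gamma (a + 1))%:E.
Proof.
move=> a0; rewrite /Gamma /Rintegral addrK fineK//.
rewrite ge0_fin_numE; last first.
  by apply: integral_ge0 => t _; rewrite lee_fin mulr_ge0 ?powR_ge0 ?expR_ge0.
apply: (@le_lt_trans _ _ (\int[mu]_(t in `[0%R, +oo[)
    (((2 * a) `^ a)%:E * (expR (- ((1 / 2) * t)))%:E))).
  apply: (@le_trans _ _ (\int[mu]_(t in `[0%R, +oo[) (t `^ a * expR (- t))%:E)).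
    apply: ge0_subset_integral => //.
    - exact: measurable_funTS (measurable_gamma_integrand a).
    - by move=> t _; rewrite lee_fin mulr_ge0 ?powR_ge0 ?expR_ge0.
    - by move=> t /=; rewrite !in_itv/= !andbT => /ltW.
  apply: ge0_le_integral => //.
  - by move=> t _; rewrite lee_fin mulr_ge0 ?powR_ge0 ?expR_ge0.
  - exact: measurable_funTS (measurable_gamma_integrand a).
  - apply/measurable_EFinP; apply: measurable_funTS; apply: measurable_funM => //.
    by apply: measurableT_comp => //; apply: measurableT_comp => //; exact: measurable_funM.
  - move=> t /=; rewrite in_itv/= andbT => t0; rewrite -EFinM lee_fin.
    apply: (@le_trans _ _ ((2 * a) `^ a * expR (t / 2) * expR (- t))%R).
      by rewrite ler_wpM2r ?expR_ge0 ?powR_le_expR.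
    rewrite -mulrA -expRD (_ : t / 2 - t = - (1 / 2 * t))%R//; by field.
rewrite ge0_integralZl//.
- by rewrite integral_expRN ?divr_gt0// -EFinM ltry.
- apply/measurable_EFinP; apply: measurable_funTS.
  by apply: measurableT_comp => //; apply: measurableT_comp => //; exact: measurable_funM.
- by rewrite lee_fin powR_ge0.
Qed.

(** The integrand is at least T^a exp (- (T + 1)) on the interval [T, T + 1], of
length 1.  As T is free, Gamma (q m + 1) outgrows every geometric sequence. *)
Lemma Gamma_ge (a T : R) : (0 <= a)%R -> (0 < T)%R ->
  (T `^ a * expR (- (T + 1)) <= Gamma (a + 1))%R.
Proof.
move=> a0 T0; rewrite -lee_fin -integral_Gamma//.
apply: (@le_trans _ _ (\int[mu]_(t in `[T, (T + 1)%R]) (t `^ a * expR (- t))%:E)); last first.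
  apply: ge0_subset_integral => //.
  - exact: measurable_funTS (measurable_gamma_integrand a).
  - by move=> t _; rewrite lee_fin mulr_ge0 ?powR_ge0 ?expR_ge0.
  - by move=> t /=; rewrite !in_itv/= andbT => /andP[/(lt_le_trans T0)].
have <- : \int[mu]_(t in `[T, (T + 1)%R]) (T `^ a * expR (- (T + 1)))%:E =
    (T `^ a * expR (- (T + 1)))%:E.
  rewrite integral_cst//= lebesgue_measure_itv/= lte_fin ltrDl ltr01 -EFinB.
  by rewrite (_ : T + 1 - T = 1)%R ?mule1//; ring.
apply: ge0_le_integral => //.
- by move=> t _; rewrite lee_fin mulr_ge0 ?powR_ge0 ?expR_ge0.
- exact: measurable_funTS (measurable_gamma_integrand a).
- move=> t /=; rewrite in_itv/= => /andP[Tt tT]; rewrite lee_fin.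
  apply: ler_pM; rewrite ?powR_ge0 ?expR_ge0 ?ler_expR ?lerN2//.
  by apply: ge0_ler_powR; rewrite ?nnegrE// ltW// (lt_le_trans T0).
Qed.

Lemma Gamma_gt0 (a : R) : (0 <= a)%R -> (0 < Gamma (a + 1))%R.
Proof.
move=> a0; apply: lt_le_trans (Gamma_ge a0 ltr01).
by rewrite mulr_gt0 ?powR_gt0 ?expR_gt0.
Qed.

Lemma cvg_integral_exhaustion (a b : nat -> R) (f : R -> \bar R) :
  {homo a : n m / (n <= m)%N >-> (m <= n)%R} ->
  {homo b : n m / (n <= m)%N >-> (n <= m)%R} ->
  (forall n, 0 < a n)%R ->
  (forall x, (0 < x)%R -> exists n, (a n <= x <= b n)%R) ->
  measurable_fun setT f -> (forall x, (0 < x)%R -> 0 <= f x) ->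
  \int[mu]_(x in `[a i, b i]) f x @[i --> \oo] --> \int[mu]_(x in `]0%R, +oo[) f x.
Proof.
move=> ha hb a0 ab mf f0.
have -> : `]0%R, +oo[%classic = \bigcup_i `[a i, b i]%classic.
  apply/seteqP; split => x /=; rewrite in_itv/= andbT.
    by move=> /ab[n xn]; exists n => //=; rewrite in_itv.
  by move=> [n _ /=]; rewrite in_itv/= => /andP[+ _]; exact: lt_le_trans.
apply: ge0_nondecreasing_set_cvg_integral => //.
- move=> n m nm; apply/subsetPset => x /=; rewrite !in_itv/= => /andP[ax xb].
  by rewrite (le_trans (ha _ _ nm) ax) (le_trans xb (hb _ _ nm)).
- by move=> i; exact: measurable_funTS.
- move=> i x /=; rewrite in_itv/= => /andP[ax _]; apply: f0; exact: lt_le_trans ax.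
Qed.

Lemma continuous_powR_pos (a x : R) : (0 < x)%R -> {for x, continuous (fun y : R => y `^ a)%R}.
Proof.
move=> x0; apply/differentiable_continuous/derivable1_diffP.
by have [] := is_derive1_powR a x0.
Qed.

Lemma integral_powR_subst_itv (q a b : R) (G : R -> R) : (0 < q)%R -> (0 < a)%R -> (a <= b)%R ->
  (forall x, (0 < x)%R -> {for x, continuous G}) ->
  \int[mu]_(s in `[(a `^ q)%R, (b `^ q)%R]) (G s)%:E =
  \int[mu]_(u in `[a, b]) (G (u `^ q) * (q * u `^ (q - 1)))%:E.
Proof.
move=> q0 a0 ab cG.
have dF x : (0 < x)%R -> ((fun y : R => y `^ q)%R^`()%classic) x = (q * x `^ (q - 1))%R.
  by move=> x0; rewrite powR_derive1// in_itv/= x0.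
have cdF x : (0 < x)%R -> {for x, continuous ((fun y : R => y `^ q)%R^`()%classic)}.
  move=> x0; rewrite /prop_for /continuous_at dF//.
  apply: (@cvg_trans _ ((q * y `^ (q - 1))%R @[y --> x])).
    apply: near_eq_cvg; near=> y; rewrite dF//; near: y; exact: lt_nbhsr.
  exact: (cvgM (cvg_cst q) (@continuous_powR_pos (q - 1) x x0)).
rewrite (@integration_by_substitution_increasing _ (fun y => y `^ q)%R G a b)//.
- apply: eq_integral => x; rewrite inE/= in_itv/= => /andP[ax _].
  by rewrite fctE /= dF// (lt_le_trans a0).
- move=> x y; rewrite !in_itv/= => /andP[ax _] /andP[ay _] xy.
  by rewrite gt0_ltr_powR ?nnegrE ?(le_trans (ltW a0)).
- by move=> x; rewrite in_itv/= => /andP[ax _]; apply: cdF; exact: lt_trans ax.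
- apply/cvg_ex; eexists; apply: cvg_at_right_filter; exact: cdF.
- apply/cvg_ex; eexists; apply: cvg_at_left_filter; apply: cdF; exact: lt_le_trans ab.
- split.
  + move=> x; rewrite in_itv/= => /andP[ax _].
    by have [] := is_derive1_powR q (lt_trans a0 ax).
  + apply: cvg_at_right_filter; exact: continuous_powR_pos.
  + apply: cvg_at_left_filter; apply: continuous_powR_pos; exact: lt_le_trans ab.
- apply: continuous_in_subspaceT => x; rewrite inE/= in_itv/= => /andP[ax _].
  by apply: cG; rewrite (lt_le_trans _ ax)// powR_gt0.
Unshelve. all: by end_near. Qed.

(** The derivative of u^q may blow up at 0 or at infinity, and G at 0, so the
substitution is made on compact intervals that exhaust the half-line. *)
Lemma integral_powR_subst (q : R) (G : R -> R) : (0 < q)%R ->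
  (forall x, (0 < x)%R -> {for x, continuous G}) -> measurable_fun setT G ->
  (forall x, 0 < x -> 0 <= G x)%R ->
  \int[mu]_(s in `]0%R, +oo[) (G s)%:E =
  \int[mu]_(u in `]0%R, +oo[) (G (u `^ q) * (q * u `^ (q - 1)))%:E.
Proof.
move=> q0 cG mG G0.
pose a n : R := (n.+1%:R^-1)%R.
pose b n : R := (n.+1%:R)%R.
have a0 n : (0 < a n)%R by rewrite invr_gt0.
have b0 n : (0 < b n)%R by [].
have ha : {homo a : n m / (n <= m)%N >-> (m <= n)%R}.
  by move=> n m nm; rewrite /a lef_pV2 ?posrE// ler_nat.
have hb : {homo b : n m / (n <= m)%N >-> (n <= m)%R}.
  by move=> n m nm; rewrite /b ler_nat.
have hab x : (0 < x)%R -> exists n, (a n <= x <= b n)%R.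
  (* This bound dominates both x and 1/x. *)
  move=> x0; exists (Num.truncn (x + x^-1)).
  have [h1 h2] : (x <= b (Num.truncn (x + x^-1)) /\ x^-1 <= b (Num.truncn (x + x^-1)))%R.
    have := truncnS_gt (x + x^-1); rewrite -/(b _) => /ltW h.
    by split; apply: le_trans h; rewrite ?lerDl ?lerDr ltW// invr_gt0.
  apply/andP; split; last exact: h1.
  by rewrite /a invf_ple ?posrE//; exact: h2.
have pqa n : (a n <= b n)%R by rewrite (@le_trans _ _ 1%R)// ?invf_le1 ?ler1n.
have h1 : \int[mu]_(x in `[(a i `^ q)%R, (b i `^ q)%R])
    (G x)%:E @[i --> \oo] --> \int[mu]_(x in `]0%R, +oo[) (G x)%:E.
  apply: (@cvg_integral_exhaustion (fun i => a i `^ q)%R (fun i => b i `^ q)%R) => //.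
  - by move=> n m nm; apply: ge0_ler_powR;
      rewrite ?nnegrE ?(ltW q0) ?(ltW (a0 _)) ?(ltW (b0 _))//; exact: ha.
  - by move=> n m nm; apply: ge0_ler_powR;
      rewrite ?nnegrE ?(ltW q0) ?(ltW (a0 _)) ?(ltW (b0 _))//; exact: hb.
  - by move=> n; rewrite powR_gt0.
  - move=> x x0; have [n /andP[an bn]] := hab (x `^ q^-1)%R (powR_gt0 _ x0); exists n.
    have -> : x = ((x `^ q^-1) `^ q)%R by rewrite -powRrM mulVf ?gt_eqF// powRr1// ltW.
    by apply/andP; split; apply: ge0_ler_powR;
        rewrite ?nnegrE ?powR_ge0 ?(ltW q0) ?(ltW (a0 _)) ?(ltW (b0 _)).
  - exact/measurable_EFinP.
have h2 : \int[mu]_(u in `[a i, b i]) (G (u `^ q) * (q * u `^ (q - 1)))%:E @[i --> \oo] -->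
   \int[mu]_(u in `]0%R, +oo[) (G (u `^ q) * (q * u `^ (q - 1)))%:E.
  apply: cvg_integral_exhaustion => //.
  - apply/measurable_EFinP; apply: measurable_funM.
      by apply: measurableT_comp => //; exact: measurable_powR.
    by apply: measurable_funM => //; exact: measurable_powR.
  - by move=> x x0; rewrite lee_fin mulr_ge0 ?G0 ?powR_gt0// mulr_ge0 ?powR_ge0// ltW.
move: h1; under eq_fun do rewrite integral_powR_subst_itv//.
by move=> h1; exact: (cvg_unique _ h1 h2).
Qed.

(** The substitution s = u^q turns the integrand into q u^(q m) exp (- u). *)
Lemma integral_radial_moment (q : R) (m : nat) : (0 < q)%R ->
  \int[mu]_(s in `]0%R, +oo[) (s ^+ m * s `^ (q^-1 - 1) * expR (- (s `^ q^-1)))%:E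
  = q%:E * (Gamma (q * m%:R + 1))%:E.
Proof.
move=> q0.
rewrite (@integral_powR_subst q (fun s => s ^+ m * s `^ (q^-1 - 1) * expR (- (s `^ q^-1)))%R)//.
- rewrite -integral_Gamma ?mulr_ge0 ?ler0n ?(ltW q0)//.
  rewrite -ge0_integralZl//; last 3 first.
  + exact: measurable_funTS (measurable_gamma_integrand _).
  + by move=> t _; rewrite lee_fin mulr_ge0 ?powR_ge0 ?expR_ge0.
  + by rewrite lee_fin ltW.
  apply: eq_integral => u; rewrite inE/= in_itv/= andbT => u0.
  rewrite -EFinM; congr EFin.
  have un0 : u != 0%R by rewrite gt_eqF.
  rewrite -!powRrM divff ?gt_eqF// powRr1 ?ltW//.
  rewrite -powR_mulrn ?powR_ge0// -powRrM.
  have u1 : (u `^ (q * (q^-1 - 1)) * u `^ (q - 1) = 1)%R.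
    rewrite -powRD ?un0 ?implybT// (_ : _ + _ = 0)%R ?powRr0//.
    by field; rewrite gt_eqF.
  transitivity (q * (u `^ (q * m%:R) * (u `^ (q * (q^-1 - 1)) * u `^ (q - 1)) * expR (- u)))%R;
      first by ring.
  by rewrite u1; ring.
- move=> x x0; apply: continuousM.
    by apply: continuousM; [exact: exprn_continuous|exact: continuous_powR_pos].
  apply: continuous_comp; last exact: continuous_expR.
  by apply: continuousN; exact: continuous_powR_pos.
- apply: measurable_funM; first by apply: measurable_funM;
    [exact: measurable_funX|exact: measurable_powR].
  by apply: measurableT_comp => //; apply: measurableT_comp => //; exact: measurable_powR.
- by move=> x x0; rewrite !mulr_ge0 ?powR_ge0 ?expR_ge0// exprn_ge0// ltW.
Qed.
End gamma.

(** * Limits of complex sequences *)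

Section complex_limits.
Variable R : realType.
Local Notation C := R[i].
Local Notation ReC := (@complex.Re R).
Local Notation ImC := (@complex.Im R).
Local Notation nc := (@Normc.normc R).
Implicit Types (z w : C).

Lemma ReD z w : ReC (z + w) = ReC z + ReC w. Proof. by case: z; case: w. Qed.
Lemma ImD z w : ImC (z + w) = ImC z + ImC w. Proof. by case: z; case: w. Qed.
Lemma ReB z w : ReC (z - w) = ReC z - ReC w. Proof. by case: z; case: w. Qed.
Lemma ImB z w : ImC (z - w) = ImC z - ImC w. Proof. by case: z; case: w. Qed.

Lemma Re_sum (I : Type) (r : seq I) (P : pred I) (F : I -> C) :
  ReC (\sum_(i <- r | P i) F i) = \sum_(i <- r | P i) ReC (F i).
Proof. exact: (big_morph _ ReD). Qed.
Lemma Im_sum (I : Type) (r : seq I) (P : pred I) (F : I -> C) :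
  ImC (\sum_(i <- r | P i) F i) = \sum_(i <- r | P i) ImC (F i).
Proof. exact: (big_morph _ ImD). Qed.

Lemma norm_ncE z : `|z| = (nc z)%:C. Proof. by rewrite normc_def; case: z. Qed.

Lemma sqr_nc z : nc z ^+ 2 = ReC z ^+ 2 + ImC z ^+ 2.
Proof. by case: z => a b /=; rewrite sqr_sqrtr// addr_ge0 ?sqr_ge0. Qed.

Lemma nc_ge0 z : 0 <= nc z. Proof. by case: z => a b; exact: sqrtr_ge0. Qed.

Lemma ncD z w : nc (z + w) <= nc z + nc w. Proof. exact: le_normcD. Qed.

Lemma ncN z : nc (- z) = nc z. Proof. exact: normcN. Qed.

Lemma nc_sum (I : Type) (r : seq I) (P : pred I) (F : I -> C) :
  nc (\sum_(i <- r | P i) F i) <= \sum_(i <- r | P i) nc (F i).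
Proof.
apply: (big_ind2 (fun z x => nc z <= x)) => //; first by rewrite Normc.normc0.
by move=> z x w y zx wy; rewrite (le_trans (ncD _ _))// lerD.
Qed.

Lemma ncX z n : nc (z ^+ n) = nc z ^+ n.
Proof.
elim: n => [|n IH]; first by rewrite !expr0 Normc.normc1.
by rewrite !exprS Normc.normcM IH.
Qed.

Lemma nc_real (x : R) : nc x%:C = `|x|.
Proof. by rewrite /= expr0n/= addr0 sqrtr_sqr. Qed.

Lemma Re_le_nc z : `|ReC z| <= nc z.
Proof. by rewrite -lecR -norm_ncE normc_ge_Re. Qed.

Lemma Im_le_nc z : `|ImC z| <= nc z.
Proof. by case: z => a b /=; rewrite -sqrtr_sqr ler_wsqrtr// lerDr sqr_ge0. Qed.

Lemma nc_le_ReIm z : nc z <= `|ReC z| + `|ImC z|.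
Proof.
have h : 0 <= `|ReC z| + `|ImC z| by rewrite addr_ge0.
rewrite -(@ler_pXn2r _ 2)// ?nnegrE ?nc_ge0// sqr_nc sqrrD !real_normK ?num_real//.
by rewrite lerD2r lerDl mulrn_wge0// mulr_ge0.
Qed.

Lemma cvg_complexP (u : nat -> C^o) (l : C^o) :
  u @ \oo --> l <-> (ReC (u n) @[n --> \oo] --> ReC l /\ ImC (u n) @[n --> \oo] --> ImC l).
Proof.
split=> [/cvgrPdist_lt ul|[/cvgrPdist_lt re /cvgrPdist_lt im]].
  by split; apply/cvgrPdist_lt => e e0;
    have /ul : (0 < e%:C :> C) by [rewrite (ltcR 0)];
    apply: filterS => n; rewrite norm_ncE ltcR -?ReB -?ImB;
    apply: le_lt_trans; [exact: Re_le_nc|exact: Im_le_nc].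
apply/cvgrPdist_lt => -[e e'] /=; rewrite ltcE /= => /andP[/eqP -> e0].
have e20 : 0 < e / 2 by rewrite divr_gt0.
near=> n; rewrite -/(e%:C) norm_ncE ltcR (le_lt_trans (nc_le_ReIm _))// ReB ImB.
rewrite [ltRHS](splitr e) ltrD//; near: n; [exact: re|exact: im].
Unshelve. all: by end_near. Qed.

Lemma cvg_nc (u : nat -> C^o) (l : C^o) : u @ \oo --> l -> nc (u n) @[n --> \oo] --> nc l.
Proof.
move=> /cvg_norm /cvg_complexP[h _].
have -> : (fun n => nc (u n)) = (fun n => ReC `|u n : C|) by apply/funext => n; rewrite norm_ncE.
have -> : nc l = ReC `|l : C| by rewrite norm_ncE.
exact: h.
Qed.

End complex_limits.

(** * Everywhere convergent power series *)

Section power_series.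
Variable R : realType.
Local Notation C := R[i].
Local Notation nc := (@Normc.normc R).
Local Notation ReC := (@complex.Re R).
Local Notation ImC := (@complex.Im R).
Implicit Types (a : nat -> C) (f : C -> C).

Definition cpseries a (z : C) : nat -> C^o := series (fun m => a m * z ^+ m).

(** The functions with an expansion are the entire ones; the coefficients are kept
apparent because the norm is computed from them. *)
Definition expansion a f := forall z, cpseries a z @ \oo --> (f z : C^o).

Definition abs_pseries a (rho : R) : nat -> R := series (fun m => nc (a m) * rho ^+ m).

Definition everywhere_summable a := forall rho, 0 <= rho -> cvgn (abs_pseries a rho).

Lemma cvg_geometric_bound (B : R) (u : nat -> R) :
  (forall m, 0 <= u m <= B * 2^-1 ^+ m) -> cvgn (series u).
Proof.
move=> uB.
have u0 m : 0 <= u m by have /andP[] := uB m.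
apply: (@series_le_cvg _ u (geometric B 2^-1)) => //.
- by move=> m; apply: le_trans (u0 m) _; have /andP[] := uB m.
- by move=> m; have /andP[] := uB m.
- by apply: is_cvg_geometric_series; rewrite ger0_norm ?invr_ge0// invf_lt1// ltr1n.
Qed.

(** The terms of a convergent series are bounded; at the point r = 2 rho + 1 this
makes the terms at rho smaller than those of a geometric series of ratio 1/2. *)
Lemma expansion_summable a f : expansion a f -> everywhere_summable a.
Proof.
move=> af rho rho0; pose r := 2 * rho + 1.
have r0 : 0 < r by rewrite ltr_wpDl ?mulr_ge0.
have bnd : bounded_fun (fun m => nc (a m) * r ^+ m).
  apply: cvg_seq_bounded; apply/cvg_ex; exists (nc 0).
  have -> : (fun m => nc (a m) * r ^+ m) = (fun m => nc (a m * r%:C ^+ m)).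
    by apply/funext => m; rewrite Normc.normcM ncX nc_real ger0_norm// ltW.
  have /cvgP/cvg_series_cvg_0 h := af r%:C.
  exact: (@cvg_nc _ (fun m => a m * r%:C ^+ m) 0).
have [B [_ hB]] := bnd.
apply: (@cvg_geometric_bound (B + 1)) => m.
rewrite mulr_ge0 ?nc_ge0 ?exprn_ge0//=.
have := hB (B + 1); rewrite ltrDl => /(_ ltr01 m I) /=.
rewrite ger0_norm ?mulr_ge0 ?nc_ge0 ?exprn_ge0 ?(ltW r0)// => hm.
have rr : rho <= r * 2^-1 by rewrite /r; lra.
apply: (@le_trans _ _ (nc (a m) * (r * 2^-1) ^+ m)).
  by rewrite ler_wpM2l ?nc_ge0// lerXn2r ?nnegrE ?mulr_ge0 ?(ltW r0).
by rewrite exprMn mulrA ler_wpM2r// exprn_ge0.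
Qed.

Lemma summable_expansion a : everywhere_summable a ->
  expansion a (fun z => lim (cpseries a z @ \oo)).
Proof.
move=> sa z.
have sz := sa _ (nc_ge0 z).
have cvgRe : cvgn (series (fun m => ReC (a m * z ^+ m))).
  apply: normed_cvg; apply: (@series_le_cvg _ _ (fun m => nc (a m) * nc z ^+ m)) => //.
  - by move=> m /=.
  - by move=> m /=; rewrite mulr_ge0 ?exprn_ge0 ?nc_ge0.
  - by move=> m /=; rewrite -ncX -Normc.normcM Re_le_nc.
have cvgIm : cvgn (series (fun m => ImC (a m * z ^+ m))).
  apply: normed_cvg; apply: (@series_le_cvg _ _ (fun m => nc (a m) * nc z ^+ m)) => //.
  - by move=> m /=.
  - by move=> m /=; rewrite mulr_ge0 ?exprn_ge0 ?nc_ge0.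
  - by move=> m /=; rewrite -ncX -Normc.normcM Im_le_nc.
suff h : cvgn (cpseries a z) by exact: h.
apply/cvg_ex; exists (limn (series (fun m => ReC (a m * z ^+ m)))
  +i* limn (series (fun m => ImC (a m * z ^+ m)))).
apply/cvg_complexP; split => /=.
  by under eq_fun do rewrite /cpseries /series/= Re_sum; exact: cvgRe.
by under eq_fun do rewrite /cpseries /series/= Im_sum; exact: cvgIm.
Qed.

Lemma abs_pseries_nd a rho : 0 <= rho ->
  {homo abs_pseries a rho : n m / (n <= m)%N >-> n <= m}.
Proof.
move=> rho0; apply: nondecreasing_series => m _ _.
by rewrite mulr_ge0 ?nc_ge0 ?exprn_ge0.
Qed.

Lemma abs_pseries_le_lim a rho N : everywhere_summable a -> 0 <= rho ->
  abs_pseries a rho N <= limn (abs_pseries a rho).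
Proof.
by move=> sa rho0; apply: nondecreasing_cvgn_le; [exact: abs_pseries_nd|exact: sa].
Qed.

Lemma cpseries_le a rho z N : nc z <= rho -> nc (cpseries a z N) <= abs_pseries a rho N.
Proof.
move=> zr; rewrite /cpseries /abs_pseries /series /=.
apply: le_trans (nc_sum _ _ _) _; apply: ler_sum => m _.
by rewrite Normc.normcM ncX ler_wpM2l ?nc_ge0// lerXn2r ?nnegrE ?nc_ge0// (le_trans (nc_ge0 z)).
Qed.

Lemma cpseries_tail_le a rho z N M : nc z <= rho -> (N <= M)%N ->
  nc (cpseries a z M - cpseries a z N) <= abs_pseries a rho M - abs_pseries a rho N.
Proof.
move=> zr NM; rewrite /cpseries /abs_pseries !sub_series NM.
apply: le_trans (nc_sum _ _ _) _; apply: ler_sum => m _.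
by rewrite Normc.normcM ncX ler_wpM2l ?nc_ge0// lerXn2r ?nnegrE ?nc_ge0// (le_trans (nc_ge0 z)).
Qed.

(** The bound depends on z through rho only: the partial sums converge uniformly
on discs. *)
Lemma expansion_tail_le a f rho z N : expansion a f -> nc z <= rho ->
  nc (f z - cpseries a z N) <= limn (abs_pseries a rho) - abs_pseries a rho N.
Proof.
move=> af zr; have rho0 := le_trans (nc_ge0 z) zr.
have h1 : nc (cpseries a z M - cpseries a z N) @[M --> \oo] --> nc (f z - cpseries a z N).
  by apply: cvg_nc; apply: cvgB; [exact: af|exact: cvg_cst].
apply: (ler_cvg_to h1).
  apply: cvgB; [|exact: cvg_cst]; exact: (expansion_summable af rho0).
by exists N => // M /= NM; exact: cpseries_tail_le.
Qed.

Lemma expansion_le a f rho z : expansion a f -> nc z <= rho ->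
  nc (f z) <= limn (abs_pseries a rho).
Proof.
move=> af zr; have := expansion_tail_le 0 af zr.
by rewrite /cpseries /abs_pseries /series/= !big_geq// !subr0.
Qed.

Lemma expansion_comb a b f g (s : C) : expansion a f -> expansion b g ->
  expansion (fun m => a m + s * b m) (fun z => f z + s * g z).
Proof.
move=> af bg z.
have -> : cpseries (fun m => a m + s * b m) z =
    (fun n => cpseries a z n + s * cpseries b z n : C^o).
  apply/funext => n; rewrite /cpseries /series/= mulr_sumr -big_split/=.
  by apply: eq_bigr => m _; rewrite mulrDl mulrA.
by apply: cvgD; [exact: af|apply: cvgM; [exact: cvg_cst|exact: bg]].
Qed.

Lemma expansion_sum (n : nat) (a : 'I_n -> nat -> C) (f : 'I_n -> C -> C) (s : 'I_n -> C) :
  (forall j, expansion (a j) (f j)) ->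
  expansion (fun m => \sum_j s j * a j m) (fun z => \sum_j s j * f j z).
Proof.
move=> af z.
have -> : cpseries (fun m => \sum_j s j * a j m) z =
    (fun N => \sum_j s j * cpseries (a j) z N : C^o).
  apply/funext => N; rewrite /cpseries /series/=.
  under [RHS]eq_bigr do rewrite mulr_sumr.
  rewrite exchange_big/=; apply: eq_bigr => m _; rewrite mulr_suml.
  by apply: eq_bigr => j _; rewrite mulrA.
elim: (index_enum _) => [|j r IH].
  under eq_fun do rewrite big_nil; rewrite big_nil; exact: cvg_cst.
under eq_fun do rewrite big_cons; rewrite big_cons.
by apply: cvgD; [apply: cvgM; [exact: cvg_cst|exact: af]|exact: IH].
Qed.

(** The lower bound of Gamma at T = X^(1/q) is X^m exp (- (T + 1)), so taking X
above 2 rho |w| makes the terms geometrically small. *)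
Lemma kernel_expansion (q : R) (w : C) : 0 < q ->
  expansion (fun m => conjc w ^+ m / (Gamma (q * m%:R + 1))%:C)
    (fun z => mittag_leffler_kernel q z w).
Proof.
move=> q0.
have sa : everywhere_summable (fun m => conjc w ^+ m / (Gamma (q * m%:R + 1))%:C).
  move=> rho rho0.
  pose X := 2 * (rho * nc w) + 1.
  have X0 : 0 < X by rewrite ltr_wpDl ?mulr_ge0 ?nc_ge0.
  have T0 : 0 < X `^ q^-1 by rewrite powR_gt0.
  apply: (@cvg_geometric_bound (expR (X `^ q^-1 + 1))) => m.
  have qm0 : 0 <= q * m%:R by rewrite mulr_ge0 ?ler0n ?(ltW q0).
  apply/andP; split; first by rewrite mulr_ge0 ?nc_ge0 ?exprn_ge0.
  have G0 := Gamma_gt0 qm0.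
  have := Gamma_ge qm0 T0.
  rewrite -powRrM mulrA mulVf ?gt_eqF// mul1r powR_mulrn ?(ltW X0)// => GX.
  have ncw : nc (conjc w) = nc w by case: (w) => x y /=; rewrite sqrrN.
  rewrite Normc.normcM ncX Normc.normcV nc_real ncw gtr0_norm// mulrAC ler_pdivrMr// -exprMn.
  rewrite mulrAC [nc w * rho]mulrC.
  apply: (@le_trans _ _ (expR (X `^ q^-1 + 1) * (X ^+ m * expR (- (X `^ q^-1 + 1)))
      * 2^-1 ^+ m)); last first.
    by rewrite ler_wpM2r ?exprn_ge0// ler_wpM2l ?expR_ge0.
  rewrite mulrCA -expRD subrr expR0 mulr1 -exprMn.
  by rewrite lerXn2r ?nnegrE ?mulr_ge0 ?nc_ge0 ?(ltW X0)// /X; lra.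
move=> z; have := @summable_expansion _ sa z.
rewrite /mittag_leffler_kernel.
rewrite (_ : (series _ : nat ->
    C^o) = cpseries (fun m => conjc w ^+ m / (Gamma (q * m%:R + 1))%:C) z)//.
by apply/funext => n; apply: eq_bigr => m _; rewrite exprMn;
    change (Num.conj w) with (conjc w); ring.
Qed.

End power_series.

(** * Averages over roots of unity *)

Section roots_of_unity.
Variable R : realType.
Local Notation C := R[i].
Local Notation nc := (@Normc.normc R).
Local Notation ReC := (@complex.Re R).
Local Notation ImC := (@complex.Im R).

Lemma prim_root_exists (N : nat) : (0 < N)%N -> exists zeta : C, N.-primitive_root zeta.
Proof.
pose p : {poly C} := 'X^N - 1; have [r Dp] := closed_field_poly_normal p.
move=> N0; rewrite (monicP _) ?monicXnsubC // scale1r in Dp.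
have rn1: all N.-unity_root r by apply/allP=> z; rewrite -root_prod_XsubC -Dp.
have sz_r: (N < (size r).+1)%N by rewrite -(size_prod_XsubC r id) -Dp size_XnsubC.
have [|z] := hasP (has_prim_root N0 rn1 _ sz_r); last by exists z.
by rewrite -separable_prod_XsubC -Dp separable_Xn_sub_1 // pnatr_eq0 -lt0n.
Qed.

Lemma prim_root_nc (N : nat) (zeta : C) : (0 < N)%N -> N.-primitive_root zeta -> nc zeta = 1.
Proof.
move=> N0 /prim_expr_order z1; apply/eqP; rewrite -(pexpr_eq1 N0) ?nc_ge0//.
by rewrite -ncX z1 Normc.normc1.
Qed.

Lemma sqr_nc_conj (z : C) : (nc z ^+ 2)%:C = z * conjc z.
Proof. by rewrite -sqr_normc norm_ncE -rmorphXn. Qed.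

(** Parseval's identity on the cyclic group of order N: distinct powers of zeta
are orthogonal, because the ratio v of two of them is a root of unity other
than 1, for which the geometric sum vanishes. *)
Lemma roots_of_unity_parseval (N : nat) (zeta : C) (b : nat -> C) :
  N.-primitive_root zeta ->
  \sum_(k < N) nc (\sum_(m < N) b m * (zeta ^+ k) ^+ m) ^+ 2 =
  N%:R * \sum_(m < N) nc (b m) ^+ 2.
Proof.
move=> pz; have N0 := prim_order_gt0 pz.
have z1 : zeta * conjc zeta = 1 by rewrite -sqr_nc_conj (prim_root_nc N0 pz) expr1n.
have zN := prim_expr_order pz.
have cN : conjc zeta ^+ N = 1 by rewrite -rmorphXn/= zN conjc1.
have orth (m l : 'I_N) :
    \sum_(k < N) (zeta ^+ m * conjc zeta ^+ l) ^+ k = if m == l then N%:R else 0.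
  have [->|ml] := eqVneq m l.
    under eq_bigr do rewrite -exprMn z1 !expr1n.
    by rewrite sumr_const card_ord.
  set v := _ * _.
  have v1 : v - 1 != 0.
    rewrite subr_eq0; apply: contra ml => /eqP v1.
    have : zeta ^+ m == zeta ^+ l.
      rewrite -[X in X == _]mulr1 -[X in _ * X](expr1n _ l) -z1 exprMn mulrCA -/v.
      by rewrite -/v v1 mulr1.
    by rewrite (eq_prim_root_expr pz) !modn_small.
  apply: (mulfI v1); rewrite mulr0 -subrX1 /v exprMn -!exprM ![(_ * N)%N]mulnC !exprM zN.
  by rewrite cN !expr1n mulr1 subrr.
apply: (@complexI R); rewrite rmorph_sum rmorphM rmorph_nat rmorph_sum/=.
transitivity (\sum_(k < N) \sum_(m < N) \sum_(l < N)
    b m * conjc (b l) * (zeta ^+ m * conjc zeta ^+ l) ^+ k).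
  apply: eq_bigr => k _; rewrite sqr_nc_conj rmorph_sum/= big_distrlr/=.
  apply: eq_bigr => m _; apply: eq_bigr => l _.
  rewrite rmorphM !rmorphXn/= mulrACA; congr (_ * _).
  by rewrite exprMn -!exprM ![(k * _)%N]mulnC.
rewrite exchange_big/= mulr_sumr; apply: eq_bigr => m _.
rewrite exchange_big/= (bigD1 m)//= [X in _ + X]big1 ?addr0; last first.
  by move=> l lm; rewrite -mulr_sumr orth eq_sym (negPf lm) mulr0.
by rewrite -mulr_sumr orth eqxx sqr_nc_conj mulrC.
Qed.

End roots_of_unity.

(** * Complex functions on the plane *)

Section plane_complex.
Variable R : realType.
Local Notation C := R[i].
Local Notation nc := (@Normc.normc R).
Local Notation ReC := (@complex.Re R).
Local Notation ImC := (@complex.Im R).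
Local Notation mu := (@lebesgue_measure R).
Local Notation mu2 := (mu \x mu)%E.
Local Notation R2 := (measurableTypeR R * measurableTypeR R)%type.

Definition to_complex (p : R2) : C := p.1 +i* p.2.

Lemma nc_to_complex p : nc (to_complex p) = Num.sqrt (sqmod p).
Proof. by []. Qed.

Lemma sqr_nc_to_complex p : nc (to_complex p) ^+ 2 = sqmod p.
Proof. by rewrite nc_to_complex sqr_sqrtr// sqmod_ge0. Qed.

(** Multiplication by a complex number of modulus 1 is a rotation; it fixes sqmod,
hence every radial domain. *)
Lemma integral_unit_mul (u : C) (D : set (measurableTypeR R)) (G : C -> R -> \bar R) :
  nc u = 1 -> measurable D ->
  measurable_fun setT (fun p : R2 => G (to_complex p) (sqmod p)) ->
  (forall z r, 0 <= G z r)%E ->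
  (\int[mu2]_(p in @sqmod R @^-1` D) G (to_complex p) (sqmod p) =
  \int[mu2]_(p in @sqmod R @^-1` D) G (u * to_complex p)%R (sqmod p))%E.
Proof.
move=> u1 mD mG G0; case: u u1 => c s u1.
have cs : c ^+ 2 + s ^+ 2 = 1 by have := sqr_nc (c +i* s); rewrite u1 expr1n.
have mDD : measurable (@sqmod R @^-1` D) by exact: measurable_sqmod_preimage.
rewrite integral_mkcond [RHS]integral_mkcond.
rewrite (integral_rotation cs); last 2 first.
- by apply/(measurable_restrict _ mDD) => //; exact: measurable_funTS.
- by move=> p; rewrite patchE; case: ifP.
apply: eq_integral => p _; rewrite !patchE.
have E : sqmod (c * p.1 - s * p.2, s * p.1 + c * p.2) = sqmod p.
  rewrite /sqmod/=.
  transitivity ((c ^+ 2 + s ^+ 2) * (p.1 ^+ 2 + p.2 ^+ 2)); first by ring.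
  by rewrite cs mul1r.
rewrite E (_ : (_ \in _) = (p \in @sqmod R @^-1` D)); last first.
  by apply/idP/idP; rewrite !inE/= E.
by case: ifP => // _; congr (G _ _); rewrite /to_complex/=; congr Complex; rewrite addrC.
Qed.

Definition measurable_complex (F : R2 -> C) :=
  measurable_fun setT (ReC \o F) /\ measurable_fun setT (ImC \o F).

Lemma measurable_complexD F G : measurable_complex F -> measurable_complex G ->
  measurable_complex (fun p => F p + G p).
Proof.
move=> [rF iF] [rG iG]; split.
  rewrite (_ : _ \o _ = (fun p => ReC (F p) + ReC (G p))); first exact: measurable_funD.
  by apply/funext => p /=; rewrite ReD.
rewrite (_ : _ \o _ = (fun p => ImC (F p) + ImC (G p))); first exact: measurable_funD.
by apply/funext => p /=; rewrite ImD.
Qed.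

Lemma measurable_complexM F G : measurable_complex F -> measurable_complex G ->
  measurable_complex (fun p => F p * G p).
Proof.
move=> [rF iF] [rG iG]; split.
  rewrite (_ : _ \o _ = (fun p => ReC (F p) * ReC (G p) - ImC (F p) * ImC (G p))).
    by apply: measurable_funB; exact: measurable_funM.
  by apply/funext => p /=; case: (F p); case: (G p).
rewrite (_ : _ \o _ = (fun p => ReC (F p) * ImC (G p) + ImC (F p) * ReC (G p))).
  by apply: measurable_funD; exact: measurable_funM.
by apply/funext => p /=; case: (F p); case: (G p).
Qed.

Lemma measurable_complex_cst c : measurable_complex (fun=> c).
Proof. by split; exact: measurable_cst. Qed.

Lemma measurable_to_complex : measurable_complex to_complex.
Proof. by split; [exact: measurable_fst|exact: measurable_snd]. Qed.

Lemma measurable_cpseries (a : nat -> C) F N : measurable_complex F ->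
  measurable_complex (fun p => cpseries a (F p) N).
Proof.
move=> mF; elim: N => [|N IH].
  under eq_fun do rewrite /cpseries /series/= big_geq//; exact: measurable_complex_cst.
under eq_fun do rewrite /cpseries seriesSr/=.
apply: measurable_complexD => //; apply: measurable_complexM; first exact: measurable_complex_cst.
elim: N {IH} => [|N IH]; first by under eq_fun do rewrite expr0; exact: measurable_complex_cst.
by under eq_fun do rewrite exprS; exact: measurable_complexM.
Qed.

Lemma measurable_expansion (a : nat -> C) f F : expansion a f -> measurable_complex F ->
  measurable_complex (fun p => f (F p)).
Proof.
move=> af mF; split.
  apply: (@measurable_fun_cvg _ _ _ _ (fun N p => ReC (cpseries a (F p) N))).
    by move=> N; have [] := measurable_cpseries a N mF.
  by move=> p _; have /cvg_complexP[] := af (F p).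
apply: (@measurable_fun_cvg _ _ _ _ (fun N p => ImC (cpseries a (F p) N))).
  by move=> N; have [] := measurable_cpseries a N mF.
by move=> p _; have /cvg_complexP[] := af (F p).
Qed.

Lemma measurable_sqr_nc F : measurable_complex F ->
  measurable_fun setT (fun p => nc (F p) ^+ 2).
Proof.
move=> [rF iF]; under eq_fun do rewrite sqr_nc.
by apply: measurable_funD; exact: measurable_funX.
Qed.

End plane_complex.

(** * The norm in terms of Taylor coefficients *)

Section norm_formula.
Variable R : realType.
Variable q : R.
Hypothesis q0 : 0 < q.
Local Notation C := R[i].
Local Notation nc := (@Normc.normc R).
Local Notation mu := (@lebesgue_measure R).
Local Notation mu2 := (mu \x mu)%E.
Local Notation R2 := (measurableTypeR R * measurableTypeR R)%type.

(** The density of the norm as a function of the squared radius. *)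
Definition ML_weight (s : R) : R := s `^ (q^-1 - 1) * expR (- (s `^ q^-1)).

Lemma ML_weight_ge0 s : 0 <= ML_weight s.
Proof. by rewrite mulr_ge0 ?powR_ge0 ?expR_ge0. Qed.

Lemma measurable_ML_weight : measurable_fun setT ML_weight.
Proof.
apply: measurable_funM; first exact: measurable_powR.
by apply: measurableT_comp => //; apply: measurableT_comp => //; exact: measurable_powR.
Qed.

Let mW : measurable_fun setT (fun p : R2 => ML_weight (sqmod p)).
Proof. by apply: measurableT_comp; [exact: measurable_ML_weight|exact: measurable_sqmod]. Qed.

Let msX m : measurable_fun setT (fun p : R2 => (sqmod p ^+ m)%R : R).
Proof. by apply: measurable_funX; exact: measurable_sqmod. Qed.

Lemma ML_sqnormE (f : C -> C) :
  (ML_sqnorm q f = ((q * pi)^-1)%:E * \int[mu2]_(p in setT)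
    (nc (f (to_complex p)) ^+ 2 * ML_weight (sqmod p))%:E)%E.
Proof.
congr *%E; apply: eq_integral => p _; congr EFin.
have sq (x : R) : Num.sqrt (sqmod p) `^ x = sqmod p `^ (x / 2).
  by rewrite -powR12_sqrt ?sqmod_ge0// -powRrM mulrC.
rewrite -/(to_complex p) nc_to_complex !sq -mulrA; congr (_ * (_ * expR (- _))).
  by congr powR; field; rewrite gt_eqF.
by congr powR; field; rewrite gt_eqF.
Qed.

Lemma integral_plane_moment (m : nat) :
  (\int[mu2]_(p in setT) (sqmod p ^+ m * ML_weight (sqmod p))%:E =
  (q * pi * Gamma (q * m%:R + 1))%:E)%E.
Proof.
pose phi (s : R) := (`|s| ^+ m * ML_weight s)%:E.
have mphi : measurable_fun setT phi.
  apply/measurable_EFinP; apply: measurable_funM; last exact: measurable_ML_weight.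
  by apply: measurable_funX; exact: normr_measurable.
transitivity (\int[mu2]_(p in setT) phi (p.1 ^+ 2 + p.2 ^+ 2)%R)%E.
  by apply: eq_integral => p _; rewrite /phi ger0_norm// ?sqmod_ge0.
rewrite integral_radial; last 2 first.
- exact: measurable_funTS.
- by move=> s; rewrite lee_fin mulr_ge0 ?exprn_ge0 ?ML_weight_ge0.
rewrite -integral_itv_obnd_cbnd; last exact: measurable_funTS.
rewrite (_ : integral _ _ _ = (q%:E * (Gamma (q * m%:R + 1))%:E)%E).
  by rewrite -!EFinM; congr EFin; ring.
rewrite -integral_radial_moment//; apply: eq_integral => s.
by rewrite inE/= in_itv/= andbT => s0; rewrite /phi /ML_weight mulrA gtr0_norm.
Qed.

(** Each term of the average has the same integral, by rotation. *)
Lemma disc_average (a : nat -> C) (f : C ->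
    C) (N : nat) (zeta : C) (D : set (measurableTypeR R)) :
  expansion a f -> N.-primitive_root zeta -> measurable D ->
  (\int[mu2]_(p in @sqmod R @^-1` D) (nc (f (to_complex p)) ^+ 2 * ML_weight (sqmod p))%:E =
  \int[mu2]_(p in @sqmod R @^-1` D)
    (N%:R^-1 * (\sum_(k < N) nc (f (zeta ^+ k * to_complex p)) ^+ 2) * ML_weight (sqmod p))%:E)%E.
Proof.
move=> af pz mD; have N0 := prim_order_gt0 pz.
have mDD : measurable (@sqmod R @^-1` D) by exact: measurable_sqmod_preimage.
have mF u : measurable_fun setT (fun p : R2 =>
    (nc (f (u * to_complex p)) ^+ 2 * ML_weight (sqmod p))%:E).
  apply/measurable_EFinP; apply: measurable_funM => //; apply: measurable_sqr_nc.
  apply: (measurable_expansion af); apply: measurable_complexM; last exact: measurable_to_complex.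
  exact: measurable_complex_cst.
have F0 z s : (0 <= (nc (f z) ^+ 2 * ML_weight s)%:E)%E.
  by rewrite lee_fin mulr_ge0 ?sqr_ge0 ?ML_weight_ge0.
set I := LHS.
have Ik k : (\int[mu2]_(p in @sqmod R @^-1` D)
    (nc (f (zeta ^+ k * to_complex p)) ^+ 2 * ML_weight (sqmod p))%:E = I)%E.
  rewrite /I (@integral_unit_mul _ (zeta ^+ k) D (fun z s => (nc (f z) ^+ 2 * ML_weight s)%:E))//.
    by rewrite ncX (prim_root_nc N0 pz) expr1n.
  by have := mF 1; under eq_fun do rewrite mul1r.
under eq_integral => p _.
  rewrite -mulrA mulr_suml mulr_sumr -sumEFin.
  under eq_bigr do rewrite EFinM.
  over.
rewrite ge0_integral_sum//; last 2 first.
- by move=> k; apply: measurable_funeM; exact: measurable_funTS (mF _).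
- by move=> k p _; rewrite mule_ge0// lee_fin invr_ge0.
transitivity (\sum_(k < N) ((N%:R^-1)%:E * I))%E.
  rewrite -ge0_sume_distrl; last by move=> k _; rewrite lee_fin invr_ge0.
  rewrite sumEFin sumr_const card_ord -[X in X%:E]mulr_natr mulVf ?mul1e//.
  by rewrite pnatr_eq0 -lt0n.
apply: eq_bigr => k _; rewrite ge0_integralZl//.
- by rewrite Ik.
- exact: measurable_funTS (mF _).
Qed.

Lemma nc_dist (z w : C) : `|nc z - nc w| <= nc (z - w).
Proof.
have h (x y : C) : nc x - nc y <= nc (x - y).
  by rewrite lerBlDr -[x in leLHS](subrK y) ncD.
by rewrite ler_norml h andbT lerNl opprB -[nc (z - w)]ncN opprB h.
Qed.

(** For the N-th partial sum p of the series the average is exactly the second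
sum.  Replacing f by p changes each square |f|^2 by at most |f - p| (|f| + |p|),
which is at most the tail of the majorant series times twice its sum. *)
Lemma root_average_close (a : nat -> C) (f : C -> C) (N : nat) (zeta z : C) (rho : R) :
  expansion a f -> N.-primitive_root zeta -> nc z <= rho ->
  `|N%:R^-1 * (\sum_(k < N) nc (f (zeta ^+ k * z)) ^+ 2) -
    \sum_(0 <= m < N) nc (a m) ^+ 2 * (nc z ^+ 2) ^+ m| <=
  2 * limn (abs_pseries a rho) * (limn (abs_pseries a rho) - abs_pseries a rho N).
Proof.
move=> af pz zr; have N0 := prim_order_gt0 pz.
have NR0 : 0 < N%:R :> R by rewrite ltr0n.
set S := limn _; set T := S - _.
have -> : \sum_(0 <= m < N) nc (a m) ^+ 2 * (nc z ^+ 2) ^+ m =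
    N%:R^-1 * \sum_(k < N) nc (cpseries a (zeta ^+ k * z) N) ^+ 2.
  apply: (mulfI (lt0r_neq0 NR0)); rewrite mulrA mulfV ?gt_eqF// mul1r big_mkord.
  have := roots_of_unity_parseval (fun m => a m * z ^+ m) pz.
  under [X in _ = _ * X -> _]eq_bigr do rewrite Normc.normcM ncX exprMn exprAC.
  move=> <-; apply: eq_bigr => k _; congr (nc _ ^+ 2).
  rewrite /cpseries /series/= big_mkord; apply: eq_bigr => m _.
  by rewrite exprMn mulrCA mulrC mulrA.
have zk k : nc (zeta ^+ k * z) <= rho.
  by rewrite Normc.normcM ncX (prim_root_nc N0 pz) expr1n mul1r.
rewrite -mulrBr -sumrB normrM gtr0_norm ?invr_gt0// ler_pdivrMl//.
apply: le_trans (ler_norm_sum _ _ _) _.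
apply: (@le_trans _ _ (\sum_(k < N) 2 * S * T)); last first.
  by rewrite sumr_const card_ord -[leLHS]mulr_natl.
apply: ler_sum => k _; rewrite subr_sqr normrM mulrC.
have fS := expansion_le af (zk k).
have pS : nc (cpseries a (zeta ^+ k * z) N) <= S.
  apply: le_trans (cpseries_le a N (zk k)) _; apply: abs_pseries_le_lim.
    exact: expansion_summable af.
  exact: le_trans (nc_ge0 _) zr.
apply: ler_pM => //.
  by rewrite ger0_norm ?addr_ge0 ?nc_ge0// [leRHS]mulrDl mul1r lerD.
by apply: le_trans (nc_dist _ _) _; exact: expansion_tail_le.
Qed.

Let mterm (a : nat -> C) m : measurable_fun setT
  (fun p : R2 => (nc (a m) ^+ 2 * (sqmod p ^+ m * ML_weight (sqmod p)))%:E).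
Proof.
apply/measurable_EFinP; apply: measurable_funM => //.
by apply: measurable_funM => //; exact: msX.
Qed.

Let term_ge0 (a : nat -> C) m (p : R2) :
  (0 <= (nc (a m) ^+ 2 * (sqmod p ^+ m * ML_weight (sqmod p)))%:E)%E.
Proof. by rewrite lee_fin mulr_ge0 ?sqr_ge0// mulr_ge0 ?exprn_ge0 ?sqmod_ge0 ?ML_weight_ge0. Qed.

(** The left-hand side is the integral of the averages over roots of unity of any
order, which converge pointwise to the series; on the disc they are dominated
by a constant times the weight. *)
Lemma disc_parseval (a : nat -> C) (f : C -> C) (rho : R) : expansion a f -> 0 <= rho ->
  (\int[mu2]_(p in @sqmod R @^-1` `]-oo, (rho ^+ 2)%R])
     (nc (f (to_complex p)) ^+ 2 * ML_weight (sqmod p))%:E =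
   \int[mu2]_(p in @sqmod R @^-1` `]-oo, (rho ^+ 2)%R])
     \sum_(0 <= m <oo) (nc (a m) ^+ 2 * (sqmod p ^+ m * ML_weight (sqmod p)))%:E)%E.
Proof.
move=> af rho0; set D := (_ @^-1` _).
have mD : measurable D by exact: measurable_sqmod_preimage.
have Dnc p : D p -> nc (to_complex p) <= rho.
  rewrite /D/= in_itv/= => h; rewrite -(@ler_pXn2r _ 2)// ?nnegrE ?nc_ge0//.
  by rewrite sqr_nc_to_complex.
pose S := limn (abs_pseries a rho).
have sa := expansion_summable af.
have S0 : 0 <= S.
  by apply: le_trans (abs_pseries_le_lim 0 sa rho0); rewrite /abs_pseries /series/= big_geq.
have [zeta pz] : exists zeta : nat -> C, forall n, n.+1.-primitive_root (zeta n).
  have h n := @prim_root_exists R n.+1 isT.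
  by exists (fun n => projT1 (cid (h n))) => n; exact: projT2 (cid (h n)).
pose A n p := n.+1%:R^-1 * (\sum_(k < n.+1) nc (f (zeta n ^+ k * to_complex p)) ^+ 2).
pose P n (p : R2) := \sum_(0 <= m < n.+1) nc (a m) ^+ 2 * (sqmod p) ^+ m.
have AP n p : D p -> `|A n p - P n p| <= 2 * S * (S - abs_pseries a rho n.+1).
  move=> /Dnc Dp; rewrite /P -sqr_nc_to_complex; exact: root_average_close.
have cvgA p : D p -> (A n p * ML_weight (sqmod p))%:E @[n --> \oo] -->
    (\sum_(0 <= m <oo) (nc (a m) ^+ 2 * (sqmod p ^+ m * ML_weight (sqmod p)))%:E)%E.
  move=> Dp.
  (* P n is a partial sum of the limit, and A n - P n tends to 0. *)
  have -> : (fun n => (A n p * ML_weight (sqmod p))%:E) =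
      (fun n => ((A n p - P n p) * ML_weight (sqmod p))%:E + (P n p * ML_weight (sqmod p))%:E)%E.
    by apply/funext => n; rewrite -EFinD -mulrDl subrK.
  rewrite -[X in _ --> X]add0e; apply: cvgeD => //.
    apply: cvg_EFin; first by near=> n.
    rewrite /comp/= -(mul0r (ML_weight (sqmod p))); apply: cvgM; last exact: cvg_cst.
    apply/norm_cvg0P.
    apply: (@squeeze_cvgr _ _ _ _ (fun=> 0) (fun n => 2 * S * (S - abs_pseries a rho n.+1))).
    - by near=> n; rewrite normr_ge0 AP.
    - exact: cvg_cst.
    - rewrite -(mulr0 (2 * S)) -(subrr S); apply: cvgM; first exact: cvg_cst.
      apply: cvgB; first exact: cvg_cst.
      have h : abs_pseries a rho n @[n --> \oo] --> S by exact: (sa _ rho0).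
      by move: h; rewrite -cvg_shiftS.
  have -> : (fun n => (P n p * ML_weight (sqmod p))%:E) =
      (fun n => (\sum_(0 <= m < n.+1)
          (nc (a m) ^+ 2 * (sqmod p ^+ m * ML_weight (sqmod p)))%:E)%E).
    by apply/funext => n; rewrite sumEFin /P mulr_suml; congr EFin; apply: eq_bigr => m _;
        rewrite -mulrA.
  rewrite (cvg_shiftS (fun n =>
      (\sum_(0 <= m < n) (nc (a m) ^+ 2 * (sqmod p ^+ m * ML_weight (sqmod p)))%:E)%E)).
  by apply: is_cvg_nneseries => m _ _; exact: term_ge0.
have A0 n p : 0 <= A n p.
  by rewrite mulr_ge0 ?invr_ge0// sumr_ge0// => k _; rewrite sqr_ge0.
have AS n p : D p -> A n p <= S ^+ 2.
  move=> Dp; rewrite /A ler_pdivrMl//.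
  apply: (@le_trans _ _ (\sum_(k < n.+1) S ^+ 2));
      last by rewrite sumr_const card_ord -[leLHS]mulr_natl.
  apply: ler_sum => k _; rewrite lerXn2r ?nnegrE ?nc_ge0//.
  apply: (expansion_le af).
  by rewrite Normc.normcM ncX (prim_root_nc _ (pz n))// expr1n mul1r Dnc.
have mA n : measurable_fun D (fun p : R2 => (A n p * ML_weight (sqmod p))%:E).
  apply: (@measurable_funTS _ _ _ _ D); apply/measurable_EFinP; apply: measurable_funM => //.
  apply: measurable_funM => //; apply: measurable_sum => k; apply: measurable_sqr_nc.
  apply: (measurable_expansion af); apply: measurable_complexM; last exact: measurable_to_complex.
  exact: measurable_complex_cst.
have mg : measurable_fun setT (fun p : R2 => (S ^+ 2 * ML_weight (sqmod p))%:E).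
  by apply/measurable_EFinP; exact: measurable_funM.
have ig : mu2.-integrable D (fun p : R2 => (S ^+ 2 * ML_weight (sqmod p))%:E).
  apply: (@integrableS _ _ _ mu2 setT) => //.
  apply/integrableP; split => //.
  apply: (@le_lt_trans _ _ ((S ^+ 2)%:E * \int[mu2]_(p in setT)
      (sqmod p ^+ 0 * ML_weight (sqmod p))%:E)%E); last first.
    by rewrite integral_plane_moment -EFinM ltry.
  rewrite -ge0_integralZl//; last 3 first.
  - by apply/measurable_EFinP; apply: measurable_funM => //; exact: msX.
  - by move=> p _; rewrite lee_fin mulr_ge0 ?exprn_ge0 ?sqmod_ge0 ?ML_weight_ge0.
  - by rewrite lee_fin sqr_ge0.
  rewrite le_eqVlt; apply/orP; left; apply/eqP; apply: eq_integral => p _.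
  rewrite -EFinM /=; congr EFin; rewrite [sqmod p ^+ 0]expr0 mul1r ger0_norm//.
  by rewrite mulr_ge0 ?sqr_ge0 ?ML_weight_ge0.
have fg p : D p -> (S ^+ 2 * ML_weight (sqmod p))%:E \is a fin_num by [].
have bg n p : D p -> (`|(A n p * ML_weight (sqmod p))%:E| <= (S ^+ 2 * ML_weight (sqmod p))%:E)%E.
  move=> Dp; rewrite /= lee_fin ger0_norm; last by rewrite mulr_ge0 ?ML_weight_ge0.
  by rewrite ler_wpM2r ?ML_weight_ge0 ?AS.
have H : (\int[mu2]_(p in D) (A n p * ML_weight (sqmod p))%:E)%E @[n --> \oo] -->
    (\int[mu2]_(p in D) \sum_(0 <= m <oo)
        (nc (a m) ^+ 2 * (sqmod p ^+ m * ML_weight (sqmod p)))%:E)%E.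
  exact: (dominated_cvg mD mA cvgA fg ig bg).
have E n : (\int[mu2]_(p in D) (A n p * ML_weight (sqmod p))%:E =
    \int[mu2]_(p in D) (nc (f (to_complex p)) ^+ 2 * ML_weight (sqmod p))%:E)%E.
  by rewrite /D -(disc_average af (pz n)).
move: H; under eq_fun do rewrite E.
by move=> H; apply: (cvg_unique _ (@cvg_cst _ _ _ _ _) H); exact: ereal_hausdorff.
Unshelve. all: by end_near. Qed.

(** Parseval's identity on discs of integer radius passes to the limit by monotone
convergence, and the radial moments are then integrated term by term. *)
Lemma ML_sqnorm_parseval (a : nat -> C) (f : C -> C) : expansion a f ->
  ML_sqnorm q f = (\sum_(0 <= m <oo) (nc (a m) ^+ 2 * Gamma (q * m%:R + 1))%:E)%E.
Proof.
move=> af.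
pose D (n : nat) : set R2 := @sqmod R @^-1` `]-oo, (n%:R ^+ 2)%R].
have mD n : measurable (D n) by exact: measurable_sqmod_preimage.
have DT : \bigcup_n D n = setT.
  apply/seteqP; split => // p _; exists (Num.truncn (sqmod p)).+1 => //.
  rewrite /D/= in_itv/=; apply: (le_trans (ltW (truncnS_gt _))).
  by rewrite -natrX ler_nat expnS expn1 leq_pmulr.
have hD : {homo D : n m / (n <= m)%N >-> (n <= m)%O}.
  move=> n m nm; apply/subsetPset => p; rewrite /D/= !in_itv/= => /le_trans; apply.
  by rewrite lerXn2r ?nnegrE// ler_nat.
have mf : measurable_fun setT (fun p : R2 =>
    (nc (f (to_complex p)) ^+ 2 * ML_weight (sqmod p))%:E).
  apply/measurable_EFinP; apply: measurable_funM => //; apply: measurable_sqr_nc.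
  by apply: (measurable_expansion af); exact: measurable_to_complex.
have mS : measurable_fun setT (fun p : R2 =>
    \sum_(0 <= m <oo) (nc (a m) ^+ 2 * (sqmod p ^+ m * ML_weight (sqmod p)))%:E)%E.
  have := @ge0_emeasurable_sum _ _ _ setT (fun m (p : R2) =>
      (nc (a m) ^+ 2 * (sqmod p ^+ m * ML_weight (sqmod p)))%:E) xpredT.
  by apply => [m p _ _|m _]; [exact: term_ge0|exact: mterm].
have f0 i p : D i p -> (0 <= (nc (f (to_complex p)) ^+ 2 * ML_weight (sqmod p))%:E)%E.
  by move=> _; rewrite lee_fin mulr_ge0 ?sqr_ge0 ?ML_weight_ge0.
have S0 i p : D i p -> (0 <= \sum_(0 <= m <oo)
    (nc (a m) ^+ 2 * (sqmod p ^+ m * ML_weight (sqmod p)))%:E)%E.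
  by move=> _; apply: nneseries_ge0 => m _ _; exact: term_ge0.
have cL := @ge0_nondecreasing_set_cvg_integral _ _ _ D _ mu2 hD mD
  (fun i => measurable_funTS mf) f0.
have cR := @ge0_nondecreasing_set_cvg_integral _ _ _ D _ mu2 hD mD
  (fun i => measurable_funTS mS) S0.
have E : (\int[mu2]_(p in setT) (nc (f (to_complex p)) ^+ 2 * ML_weight (sqmod p))%:E =
   \int[mu2]_(p in setT) \sum_(0 <= m <oo)
       (nc (a m) ^+ 2 * (sqmod p ^+ m * ML_weight (sqmod p)))%:E)%E.
  rewrite -DT; move: cL; under eq_fun do rewrite (disc_parseval af)//.
  by move=> cL; apply: (cvg_unique _ cL cR); exact: ereal_hausdorff.
rewrite ML_sqnormE E integral_nneseries//.
rewrite -nneseriesZl; last by move=> m _; apply: integral_ge0 => p _; exact: term_ge0.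
apply: eq_eseriesr => m _.
under eq_integral do rewrite EFinM.
rewrite ge0_integralZl//; last 3 first.
- by apply/measurable_EFinP; apply: measurable_funM => //; exact: msX.
- by move=> p _; rewrite lee_fin mulr_ge0 ?exprn_ge0 ?sqmod_ge0 ?ML_weight_ge0.
- by rewrite lee_fin sqr_ge0.
rewrite integral_plane_moment -!EFinM; congr EFin.
by rewrite mulrCA [X in _ * X]mulrA mulVf ?mul1r// mulf_neq0 ?lt0r_neq0 ?pi_gt0.
Qed.

End norm_formula.

(** * The reproducing property *)

Section reproducing.
Variable R : realType.
Variable q : R.
Hypothesis q0 : 0 < q.
Local Notation C := R[i].
Local Notation nc := (@Normc.normc R).
Local Notation ReC := (@complex.Re R).
Local Notation gm m := (Gamma (q * m%:R + 1)).

Let gm0 m : 0 < gm m :> R.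
Proof. by apply: Gamma_gt0; rewrite mulr_ge0 ?ler0n ?(ltW q0). Qed.

Definition superosc_coef (n : nat) (Z z : 'I_n -> C) (m : nat) : C :=
  \sum_j Z j * (conjc (z j) ^+ m / (gm m)%:C).

Lemma superosc_expansion (n : nat) (Z z : 'I_n -> C) :
  expansion (superosc_coef Z z) (superoscillation q Z z).
Proof. by apply: expansion_sum => j; exact: kernel_expansion. Qed.

Lemma nc_sqrD (x y : C) : nc (x + y) ^+ 2 = nc x ^+ 2 + nc y ^+ 2 + 2 * ReC (conjc x * y).
Proof. by rewrite !sqr_nc; case: x => a b; case: y => c d /=; ring. Qed.

Lemma Re_mulr (x : C) (r : R) : ReC x * r = ReC (x * r%:C).
Proof. by case: x => a b /=; rewrite mulr0 subr0. Qed.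

(** The factor Gamma (q m + 1) cancels the denominator of the m-th coefficient of
each kernel, which leaves the m-th term of the Taylor series at z_j. *)
Lemma superosc_pairing (n : nat) (Z z : 'I_n -> C) (b : nat -> C) (N : nat) :
  \sum_(0 <= m < N) ReC (conjc (superosc_coef Z z m) * b m) * gm m =
  ReC (\sum_j conjc (Z j) * cpseries b (z j) N).
Proof.
have E m : ReC (conjc (superosc_coef Z z m) * b m) * gm m =
    ReC (\sum_j conjc (Z j) * (b m * z j ^+ m)).
  rewrite /superosc_coef rmorph_sum/= mulr_suml !Re_sum mulr_suml; apply: eq_bigr => j _.
  have G0 : (gm m)%:C != 0 :> C by rewrite -(rmorph0 (real_complex R))
      (inj_eq (@complexI R)) gt_eqF.
  rewrite Re_mulr; move: (gm m)%:C (conjc_real (gm m)) G0 => G GG G0.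
  rewrite !rmorphM fmorphV rmorphXn/= conjcK GG.
  by congr ReC; field.
rewrite (eq_bigr _ (fun m _ => E m)) -Re_sum exchange_big/=; congr ReC.
by apply: eq_bigr => j _; rewrite /cpseries /series/= mulr_sumr.
Qed.

Lemma cvg_superosc_pairing (n : nat) (Z z : 'I_n -> C) (b : nat -> C) (f : C -> C) :
  expansion b f ->
  \sum_(0 <= m < N) ReC (conjc (superosc_coef Z z m) * b m) * gm m @[N --> \oo] -->
  ReC (\sum_j conjc (Z j) * f (z j)).
Proof.
move=> bf; under eq_fun do rewrite superosc_pairing Re_sum.
rewrite Re_sum.
suff H (r : seq 'I_n) : \sum_(j <- r) ReC (conjc (Z j) * cpseries b (z j) N) @[N --> \oo] -->
    \sum_(j <- r) ReC (conjc (Z j) * f (z j)) by exact: H.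
elim: r => [|j r IH].
  by under eq_fun do rewrite big_nil; rewrite big_nil; exact: cvg_cst.
under eq_fun do rewrite big_cons; rewrite big_cons.
apply: cvgD; last exact: IH.
have : (fun N => conjc (Z j) * cpseries b (z j) N : C^o) @ \oo --> (conjc (Z j) * f (z j) : C^o).
  by apply: cvgM; [exact: cvg_cst|exact: bf].
by move=> /cvg_complexP[].
Qed.

(** The pairing of the superoscillation with itself; in particular the norm is
finite. *)
Lemma ML_sqnorm_superosc (n : nat) (Z z : 'I_n -> C) :
  ML_sqnorm q (superoscillation q Z z) =
  (ReC (\sum_j conjc (Z j) * superoscillation q Z z (z j)))%:E.
Proof.
rewrite (ML_sqnorm_parseval q0 (@superosc_expansion _ Z z)).
apply/cvg_lim; first exact: ereal_hausdorff.
under eq_fun do rewrite sumEFin.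
apply: cvg_EFin; first by near=> N.
rewrite (_ : _ \o _ = (fun N =>
    \sum_(0 <= m < N) ReC (conjc (superosc_coef Z z m) * superosc_coef Z z m) * gm m)).
  exact: cvg_superosc_pairing (@superosc_expansion _ Z z).
by apply/funext => N /=; apply: eq_bigr => m _; congr (_ * _);
    rewrite [conjc _ * _]mulrC -sqr_nc_conj.
Unshelve. all: by end_near. Qed.

Lemma expansion_sub (a b : nat -> C) (f g : C -> C) : expansion a f -> expansion b g ->
  expansion (fun m => a m - b m) (fun z => f z - g z).
Proof.
move=> af bg; have := expansion_comb (s := -1) af bg.
by under eq_fun do rewrite mulN1r; under [X in expansion _ X -> _]eq_fun do rewrite mulN1r.
Qed.

(** The identity holds between partial sums of the series of the three norms,
whose coefficients are b, a and b - a; the norms of g and g - f may be infinite. *)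
Lemma ML_sqnorm_shift (n : nat) (Z z : 'I_n -> C) (b : nat -> C) (g : C -> C) :
  expansion b g ->
  let f := superoscillation q Z z in
  (ML_sqnorm q g = ML_sqnorm q f + ML_sqnorm q (fun x => g x - f x)%R
   + (2 * ReC (\sum_j conjc (Z j) * (g (z j) - f (z j))))%R%:E)%E.
Proof.
move=> bg f; have af := @superosc_expansion _ Z z; pose a := superosc_coef Z z.
have hgf := expansion_sub bg af.
have T0 (c : nat -> C) m : (0 <= (nc (c m) ^+ 2 * gm m)%:E)%E.
  by rewrite lee_fin mulr_ge0 ?sqr_ge0// ltW.
rewrite [in LHS](ML_sqnorm_parseval q0 bg).
apply/cvg_lim; first exact: ereal_hausdorff.
have -> : (fun N => \sum_(0 <= m < N) (nc (b m) ^+ 2 * gm m)%:E)%E =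
  (fun N => \sum_(0 <= m < N) (nc (a m) ^+ 2 * gm m)%:E
    + \sum_(0 <= m < N) (nc (b m - a m) ^+ 2 * gm m)%:E
    + (2 * \sum_(0 <= m < N) ReC (conjc (a m) * (b m - a m)) * gm m)%:E)%E.
  apply/funext => N; rewrite mulr_sumr -sumEFin -!big_split/=; apply: eq_bigr => m _.
  rewrite -!EFinD; congr EFin; rewrite -[in LHS](subrKC (a m) (b m)) [in LHS]nc_sqrD; ring.
apply: cvgeD.
- by rewrite fin_num_adde_defl.
- apply: cvgeD.
  + by rewrite /f ML_sqnorm_superosc fin_num_adde_defr.
  + rewrite (ML_sqnorm_parseval q0 af); apply: is_cvg_nneseries => m _ _; exact: T0.
  + rewrite (ML_sqnorm_parseval q0 hgf); apply: is_cvg_nneseries => m _ _;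
      exact: (T0 (fun m => b m - a m)).
- apply: cvg_EFin; first by near=> N.
  apply: cvgM; first exact: cvg_cst.
  exact: cvg_superosc_pairing hgf.
Unshelve. all: by end_near. Qed.

Lemma ML_sqnorm_ge0 (f : C -> C) : (0 <= ML_sqnorm q f)%E.
Proof.
rewrite (ML_sqnormE q0); apply: mule_ge0.
  by rewrite lee_fin invr_ge0 mulr_ge0 ?pi_ge0// ltW.
by apply: integral_ge0 => p _; rewrite lee_fin mulr_ge0 ?sqr_ge0 ?ML_weight_ge0.
Qed.

(** The Gamma weights are positive, so all Taylor coefficients vanish. *)
Lemma ML_sqnorm_eq0 (b : nat -> C) (g : C -> C) : expansion b g ->
  (ML_sqnorm q g <= 0)%E -> forall x, g x = 0.
Proof.
move=> bg; rewrite (ML_sqnorm_parseval q0 bg) => g0 x.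
have T0 m : (0 <= (nc (b m) ^+ 2 * gm m)%:E)%E.
  by rewrite lee_fin mulr_ge0 ?sqr_ge0// ltW.
have b0 m : b m = 0.
  apply: (@Normc.eq0_normc R); apply/eqP; rewrite -sqrf_eq0.
  rewrite -(mulIr_eq0 _ (mulIf (lt0r_neq0 (gm0 m)))) eq_le.
  have -> : 0 <= nc (b m) ^+ 2 * gm m by rewrite mulr_ge0 ?sqr_ge0// ltW.
  rewrite andbT -lee_fin; apply: le_trans g0.
  have := @nneseries_lim_ge _ (fun m => (nc (b m) ^+ 2 * gm m)%:E) xpredT 0 m.+1.
  move=> /(_ (fun m _ _ => T0 m)); apply: le_trans.
  by rewrite big_nat_recr//= leeDr// sume_ge0.
have : cpseries b x @ \oo --> (0 : C^o).
  have -> : cpseries b x = (fun=> 0 : C^o).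
    by apply/funext => N; rewrite /cpseries /series/= big1// => m _; rewrite b0 mul0r.
  exact: cvg_cst.
by move=> h; apply: (cvg_unique _ (bg x) h); exact: norm_hausdorff.
Qed.

End reproducing.

(** * The regularized least squares functional *)

Section ridge.
Variable R : realType.
Variables (q lambda : R) (n : nat).
Hypotheses (q0 : 0 < q) (lambda0 : 0 < lambda).
Local Notation C := R[i].
Local Notation nc := (@Normc.normc R).
Local Notation ReC := (@complex.Re R).
Variables (Z z w : 'I_n -> C).
Let f := superoscillation q Z z.
Let J := ridge_functional q lambda z w.
(** The functional varies at first order, from the superoscillation in a direction
e, by -2 times the real part of the pairing of this vector with the values of
e at the nodes. *)
Definition ridge_residual k : C := w k - (lambda%:C * Z k + superoscillation q Z z (z k)).
Let c := ridge_residual.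

Lemma superosc_ML (Y : 'I_n -> C) : ML q (superoscillation q Y z).
Proof.
split; first by exists (superosc_coef q Y z); exact: superosc_expansion.
by rewrite (ML_sqnorm_superosc q0) ltry.
Qed.

Lemma ML_sqnorm_fin g : ML q g -> ML_sqnorm q g \is a fin_num.
Proof. by move=> [_ gfin]; rewrite ge0_fin_numE// ML_sqnorm_ge0. Qed.

Lemma ridge_fin : J f \is a fin_num.
Proof.
rewrite /J /ridge_functional -(fineK (ML_sqnorm_fin (superosc_ML Z))).
by rewrite -EFinM -EFinD.
Qed.

(** The linear terms of the data part and of the norm combine into c, as both
depend only on the values of e at the nodes. *)
Lemma ridge_shift g : entire g ->
  let e := fun x => g x - f x in
  (J g = J f + (\sum_k nc (e (z k)) ^+ 2 - 2 * ReC (\sum_k conjc (c k) * e (z k)))%R%:E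
         + lambda%:E * ML_sqnorm q e)%E.
Proof.
move=> [b bg] e; rewrite /J /ridge_functional.
have ffin : ML_sqnorm q f \is a fin_num by exact: ML_sqnorm_fin (superosc_ML Z).
rewrite (ML_sqnorm_shift q0 Z z bg) -/f -/e.
have e0 : (0 <= ML_sqnorm q e)%E by exact: ML_sqnorm_ge0.
rewrite -(fineK ffin); set F := fine _.
set x1 := \sum_k nc (w k - g (z k)) ^+ 2; set x2 := \sum_k nc (w k - f (z k)) ^+ 2.
set y := 2 * ReC (\sum_j conjc (Z j) * (g (z j) - f (z j))).
set t := \sum_k nc (e (z k)) ^+ 2 - _.
have xyt : x1 + lambda * y = x2 + t.
  rewrite /x1 /x2 /y /t !Re_sum !mulr_sumr -sumrB -!big_split/=; apply: eq_bigr => k _.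
  have -> : w k - g (z k) = (w k - f (z k)) + - e (z k) by rewrite /e; ring.
  rewrite nc_sqrD ncN -!addrA; congr (_ + (_ + _)).
  rewrite -/(e (z k)) /c /ridge_residual -/f.
  case: (w k) (f (z k)) (e (z k)) (Z k) => [w1 w2] [f1 f2] [e1 e2] [Z1 Z2] /=.
  by ring.
case: (ML_sqnorm q e) e0 => [r| |] //= r0.
  change ((x1 + lambda * (F + r + y))%:E = (x2 + lambda * F + t + lambda * r)%:E).
  congr EFin; transitivity (x1 + lambda * y + lambda * (F + r)); first by ring.
  by rewrite xyt; ring.
by rewrite addeC/= !gt0_muley ?lte_fin//.
Qed.

Lemma ridge_minimizer_residual0 :
  (forall k, c k = 0) -> is_the_minimizer J (ML q) f.
Proof.
move=> c0.
have Jg g : ML q g -> (J g = J f + (\sum_k nc (g (z k) - f (z k)) ^+ 2)%R%:E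
    + lambda%:E * ML_sqnorm q (fun x => g x - f x)%R)%E.
  move=> [eg _]; rewrite (ridge_shift eg)/=.
  by rewrite [X in 2 * ReC X]big1 ?mulr0 ?subr0// => k _; rewrite c0 conjc0 mul0r.
have s0 g : 0 <= \sum_k nc (g (z k) - f (z k)) ^+ 2.
  by apply: sumr_ge0 => k _; exact: sqr_ge0.
have Jfin := ridge_fin.
split=> [|g /Jg ->|g Mg gmin]; first exact: superosc_ML.
  rewrite -addeA leeDl// adde_ge0 ?lee_fin//.
  by rewrite mule_ge0 ?lee_fin ?(ltW lambda0)// ML_sqnorm_ge0.
have h : ((\sum_k nc (g (z k) - f (z k)) ^+ 2)%R%:E
    + lambda%:E * ML_sqnorm q (fun x => g x - f x)%R <= 0)%E.
  rewrite -(leeD2lE _ _ Jfin) adde0 addeA -(Jg g Mg); exact: gmin _ (superosc_ML Z).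
have le0 : (lambda%:E * ML_sqnorm q (fun x => g x - f x)%R <= 0)%E.
  by apply: le_trans h; rewrite leeDr// lee_fin.
have {}le0 : (ML_sqnorm q (fun x => g x - f x)%R <= 0)%E.
  by move: le0; rewrite pmule_rle0// lte_fin.
case: Mg => -[b bg] _.
apply/funext => x; apply/eqP; rewrite -subr_eq0; apply/eqP.
by apply: (ML_sqnorm_eq0 q0 (expansion_sub bg (@superosc_expansion _ _ q0 _ Z z)) le0).
Qed.

(** Otherwise the superposition K of the kernels with coefficients c is a direction
of descent. *)
Lemma minimizer_ridge_residual0 : posdefmx (gram_mx q z) ->
  (forall g, ML q g -> (J f <= J g)%E) -> forall k, c k = 0.
Proof.
move=> G min.
apply: contrapT => /existsNP[k0 ck0].
pose K := superoscillation q c z.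
have KE k : K (z k) = \sum_j c j * mittag_leffler_kernel q (z k) (z j) by [].
pose D := ReC (\sum_k conjc (c k) * K (z k)).
have D0 : 0 < D.
  have v0 : (\col_k c k : 'cV[C]_n) != 0.
    by apply/eqP => /matrixP/(_ k0 0); rewrite !mxE.
  have := G _ v0; rewrite ltcE => /andP[_]; congr (_ < _); rewrite /D; congr ReC.
  rewrite mxE; under eq_bigr do rewrite mxE mulr_suml.
  rewrite exchange_big/=; apply: eq_bigr => k _; rewrite KE mulr_sumr.
  by apply: eq_bigr => j _; rewrite !mxE -mulrA [_ * c j]mulrC.
pose A := \sum_k nc (K (z k)) ^+ 2 + lambda * D.
have A0 : 0 <= A by rewrite addr_ge0 ?mulr_ge0 ?(ltW lambda0) ?(ltW D0)// sumr_ge0// => k _;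
    exact: sqr_ge0.
(* J (f + s K) - J f = s (s A - 2 D), which is negative for this s as s A < D. *)
pose s := D / (A + 1).
have A10 : 0 < A + 1 by rewrite ltr_wpDl.
have s0 : 0 < s by rewrite divr_gt0.
pose H := superoscillation q (fun j => s%:C * c j) z.
have HE x : H x = s%:C * K x.
  by rewrite /H /K /superoscillation mulr_sumr; apply: eq_bigr => j _; rewrite mulrA.
pose g x := f x + H x.
have Hg : (fun x => g x - f x) = H by apply/funext => x; rewrite /g addrAC subrr add0r.
have eg : entire g.
  exists (fun m => superosc_coef q Z z m + 1 * superosc_coef q (fun j => s%:C * c j) z m).
  have := expansion_comb (s := 1) (@superosc_expansion _ _ q0 _ Z z)
      (@superosc_expansion _ _ q0 _ (fun j => s%:C * c j) z).
  by under [X in expansion _ X -> _]eq_fun do rewrite mul1r.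
have NH : ML_sqnorm q H = (s ^+ 2 * D)%:E.
  rewrite (ML_sqnorm_superosc q0) -/H; congr EFin.
  rewrite mulrC Re_mulr mulr_suml; congr ReC; apply: eq_bigr => k _.
  have -> : conjc (s%:C * c k) = s%:C * conjc (c k).
    by rewrite rmorphM; congr (_ * _); exact: conjc_real.
  by rewrite HE rmorphXn/=; ring.
have Jg : (J g = J f + (s * (s * A - 2 * D))%:E)%E.
  rewrite (ridge_shift eg)/= Hg NH -addeA; congr (_ + _)%E.
  rewrite -EFinM -EFinD; congr EFin.
  have -> : \sum_k nc (g (z k) - f (z k)) ^+ 2 = s ^+ 2 * \sum_k nc (K (z k)) ^+ 2.
    rewrite mulr_sumr; apply: eq_bigr => k _.
    by rewrite -[g _ - f _]/((fun x =>
        g x - f x) (z k)) Hg HE Normc.normcM exprMn nc_real gtr0_norm.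
  have -> : ReC (\sum_k conjc (c k) * (g (z k) - f (z k))) = s * D.
    rewrite mulrC Re_mulr mulr_suml; congr ReC; apply: eq_bigr => k _.
    by rewrite -[g _ - f _]/((fun x => g x - f x) (z k)) Hg HE; ring.
  by rewrite /A; ring.
have Mg : ML q g.
  split=> //; case: eg => b bg.
  rewrite (ML_sqnorm_shift q0 Z z bg) -/f Hg NH -(fineK (ML_sqnorm_fin (superosc_ML Z))).
  by rewrite -!EFinD ltry.
have Jfin := ridge_fin.
have := min _ Mg; rewrite Jg -[leLHS]adde0 (leeD2lE _ _ Jfin) lee_fin.
rewrite pmulr_rge0// leNgt => /negP; apply.
rewrite subr_lt0 /s mulrAC ltr_pdivrMr// mulrC -mulrA mulrC.
by nra.
Qed.
End ridge.

Theorem proposition5p15 (R : realType) (q : R) (n : nat) (a lambda : R)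
    (h : forall m : nat, 'I_m.+1 -> R)
    (Z : forall m : nat, R -> 'I_m.+1 -> R[i])
    (w : 'I_n.+1 -> R[i]) :
  let z := fun j : 'I_n.+1 => - 'i%C * (h n j)%:C in
  0 < q -> 1 < a -> 0 < lambda ->
  (forall j, `|h n j| <= 1) ->
  posdefmx (gram_mx q z) ->
  is_the_minimizer (ridge_functional q lambda z w) (ML q)
    (superoscillation q (Z n a) z)
  <->
  (forall k : 'I_n.+1,
     w k = lambda%:C * Z n a k
           + \sum_(j < n.+1)
               Z n a j * mittag_leffler_kernel q (- 'i%C * (h n k)%:C)
                                                 (- 'i%C * (h n j)%:C)).
Proof.
move=> z q0 _ lambda0 _ G.
have resE k : ridge_residual q lambda (Z n a) z w k = 0 <->
    w k = lambda%:C * Z n a k + \sum_(j < n.+1) Z n a j * mittag_leffler_kernel q (z k) (z j).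
  by rewrite /ridge_residual; split => [/eqP|->]; rewrite ?subrr// subr_eq0 => /eqP.
split=> [[_ fmin _] k|wE].
  by apply/resE; exact: (minimizer_ridge_residual0 q0 lambda0 G fmin).
by apply: ridge_minimizer_residual0 => // k; apply/resE; exact: wE.
Qed.
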